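(* Let $\psi\in H^\infty$ with $\psi\not\equiv 0$ on $\mathbb{D}$, and let $\psi H^\infty=\{\psi f: f\in H^\infty\}$. Then a map $T:\psi H^\infty\to\psi H^\infty$ is an automorphism of $\psi H^\infty$ if and only if $T=C_\varphi$ (restricted to $\psi H^\infty$) for some $\varphi\in\mathrm{Aut}(\mathbb{D})$ such that $\psi\circ\varphi=\psi g$, where $g$ is an invertible element of $H^\infty$.
   Context: $\mathbb{D}$ is the open unit disc in $\mathbb{C}$; $\mathrm{Aut}(\mathbb{D})$ is the set of bijective analytic self-maps of $\mathbb{D}$; $H^\infty$ is the algebra of bounded analytic functions on $\mathbb{D}$ with pointwise operations. For an analytic self-map $\varphi$ of $\mathbb{D}$, $C_\varphi f=f\circ\varphi$. An automorphism of a (not necessarily unital or closed) subalgebra is a bijective, linear, multiplicative self-map of it (no continuity is assumed). An element $g\in H^\infty$ is invertible if there is $h\in H^\infty$ with $gh\equiv 1$ on $\mathbb{D}$. *)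

(* Defs.v *)
From Stdlib Require Import Reals.
From Corelib Require Import ssreflect ssrfun.
From Coquelicot Require Import Coquelicot.

Open Scope R_scope.
Open Scope C_scope.

Record unit_disc : Type := mk_unit_disc { dval :> C; disc_lt1 : (Cmod dval < 1)%R }.

(* Functions live on the disc itself, so their equality is equality on the
   disc.  Analyticity is local expandability in a convergent power series; the
   radius r need not fit inside the disc, since only points of the disc are
   tested. *)
Definition analytic (f : unit_disc -> C) : Prop :=
  forall z0 : unit_disc, exists (a : nat -> C) (r : R), (0 < r)%R /\
    forall z : unit_disc, (Cmod (z - z0) < r)%R ->
      @is_pseries C_AbsRing C_NormedModule a (z - z0) (f z).

Definition bounded_fun (f : unit_disc -> C) : Prop :=
  exists M : R, forall z : unit_disc, (Cmod (f z) <= M)%R.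

Definition Hinfty (f : unit_disc -> C) : Prop := analytic f /\ bounded_fun f.

Definition Hinfty_invertible (g : unit_disc -> C) : Prop :=
  Hinfty g /\ exists h : unit_disc -> C, Hinfty h /\ forall z : unit_disc, g z * h z = 1.

Definition Aut_disc (phi : unit_disc -> unit_disc) : Prop :=
  analytic (fun z => dval (phi z)) /\ bijective phi.

Definition comp_op (phi : unit_disc -> unit_disc) (f : unit_disc -> C) : unit_disc -> C :=
  fun z => f (phi z).

Definition fadd (f g : unit_disc -> C) : unit_disc -> C := fun z => f z + g z.
Definition fmul (f g : unit_disc -> C) : unit_disc -> C := fun z => f z * g z.
Definition fscal (c : C) (f : unit_disc -> C) : unit_disc -> C := fun z => c * f z.

Definition psiHinfty (psi F : unit_disc -> C) : Prop :=
  exists f : unit_disc -> C, Hinfty f /\ F = fmul psi f.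

(* A self-map of a set A of functions is given by a map T on all functions
   that sends A into A; the values of T outside A are never constrained.
   A is meant to be a subalgebra, so that the arguments of T below lie in A. *)
Record automorphism_of (A : (unit_disc -> C) -> Prop)
    (T : (unit_disc -> C) -> (unit_disc -> C)) : Prop := {
  aut_maps : forall F, A F -> A (T F);
  aut_inj : forall F G, A F -> A G -> T F = T G -> F = G;
  aut_surj : forall G, A G -> exists F, A F /\ T F = G;
  aut_add : forall F G, A F -> A G -> T (fadd F G) = fadd (T F) (T G);
  aut_scal : forall c F, A F -> T (fscal c F) = fscal c (T F);
  aut_mul : forall F G, A F -> A G -> T (fmul F G) = fmul (T F) (T G)
}.

(* Main.v *)
(* Let P = T psi.  For a point z with P z <> 0, f |-> T (psi f) z / P z is a unital
   character of H^oo.  Since w - c is invertible in H^oo for |c| > 1, the character takes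
   w to a point of the closed disc, so that T (psi w) / P extends to an analytic phi with
   |phi| <= 1; phi is not constant because T is injective, hence |phi| < 1.  Dividing
   f - f (phi z) by w - phi z shows that the character is evaluation at phi z, that is
   T (psi f) = P (f o phi), and T (psi psi) = P P gives P = psi o phi.  The same argument
   for the inverse of T yields the inverse of phi.

   In the other direction the only difficulty is that the inverse of a bijective analytic
   self-map phi is analytic.  If phi a = 0, write phi = (z - a)^k h.  The minimum principle
   and injectivity show that phi is proper, so h (1 - conj a z)^k is a nonvanishing function
   whose modulus tends to 1 at the boundary, hence a constant; injectivity forces k = 1,
   and phi is a Moebius map.

   Everything rests on absolutely convergent power series, without Cauchy's theorem: the
   functions given near a point by such a series form a Banach algebra closed under
   composition, in which a nonzero element is a power of the variable times a unit. *)

Require Import Defs.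
From Stdlib Require Import Reals.
From Coquelicot Require Import Coquelicot.
From Stdlib Require Import Lra Lia ClassicalEpsilon ProofIrrelevance FunctionalExtensionality.
From Corelib Require Import ssrfun.

(** * Convergent sequences and series of complex numbers *)

(** No continuity of [T] is available, so every bound on [T (psi w)] has to come from algebra,
    namely from the invertibility of elements [w - c]. Moreover [psi H^oo] may lack a unit and
    [T psi] may have zeros. Relations are therefore kept multiplied by [T psi] and cancelled
    afterwards, which is legitimate because the analytic functions on the disc form an integral
    domain. Division is performed only where a bound [|Q| <= K |P|] is known; comparing orders of
    vanishing then makes the quotient analytic, which takes the place of Riemann's theorem on
    removable singularities. Since [analytic] provides an expansion at every point, no series is
    ever re-expanded about a new centre, and one interchange of summations yields products,
    substitutions and reciprocals alike. *)

Lemma Cminus_diag (x : C) : (x - x)%C = 0.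
Proof. ring. Qed.

(** Phrased through the real sequence of distances, so that the theory of real limits applies
    directly. *)
Definition Clim (u : nat -> C) (l : C) : Prop :=
  is_lim_seq (fun n => Cmod (u n - l)) 0.

Lemma Clim_eps (u : nat -> C) (l : C) :
  Clim u l <->
  forall e : R, (0 < e)%R -> exists N, forall n, (N <= n)%nat -> (Cmod (u n - l) < e)%R.
Proof.
  unfold Clim; rewrite <- is_lim_seq_spec; split.
  - intros H e He. destruct (H (mkposreal e He)) as [N HN].
    exists N; intros n Hn; specialize (HN n Hn); simpl in HN.
    rewrite Rminus_0_r, Rabs_pos_eq in HN; auto using Cmod_ge_0.
  - intros H [e He]; destruct (H e He) as [N HN]; exists N; intros n Hn; simpl.
    rewrite Rminus_0_r, Rabs_pos_eq; auto using Cmod_ge_0.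
Qed.

Lemma Clim_ext (u v : nat -> C) (l : C) :
  (forall n, u n = v n) -> Clim u l -> Clim v l.
Proof.
  intros H; apply is_lim_seq_ext; intros n; now rewrite H.
Qed.

Lemma Clim_const (c : C) : Clim (fun _ => c) c.
Proof.
  apply is_lim_seq_ext with (fun _ => 0%R); [|apply is_lim_seq_const].
  intros _. now rewrite Cminus_diag, Cmod_0.
Qed.

Lemma Clim_dominated (u : nat -> C) (l : C) (b : nat -> R) :
  (forall n, (Cmod (u n - l) <= b n)%R) -> is_lim_seq b 0 -> Clim u l.
Proof.
  intros H Hb; apply (is_lim_seq_le_le (fun _ => 0%R)) with b; auto.
  - intros n; split; [apply Cmod_ge_0|apply H].
  - apply is_lim_seq_const.
Qed.

Lemma Clim_plus (u v : nat -> C) (l m : C) :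
  Clim u l -> Clim v m -> Clim (fun n => u n + v n)%C (l + m)%C.
Proof.
  intros Hu Hv.
  apply Clim_dominated with (fun n => Cmod (u n - l) + Cmod (v n - m))%R.
  - intros n. replace (u n + v n - (l + m))%C with ((u n - l) + (v n - m))%C by ring.
    apply Cmod_triangle.
  - replace (Finite 0) with (Finite (0 + 0)) by (f_equal; ring).
    now apply is_lim_seq_plus'.
Qed.

Lemma Clim_mult_l (c : C) (u : nat -> C) (l : C) :
  Clim u l -> Clim (fun n => c * u n)%C (c * l)%C.
Proof.
  intros Hu. apply Clim_dominated with (fun n => Cmod c * Cmod (u n - l))%R.
  - intros n. rewrite <- Cmod_mult. right; f_equal; ring.
  - replace (Finite 0) with (Rbar_mult (Cmod c) 0) by (simpl; f_equal; ring).
    now apply is_lim_seq_scal_l.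
Qed.

Lemma Clim_incr_1 (u : nat -> C) (l : C) :
  Clim (fun n => u (S n)) l <-> Clim u l.
Proof.
  symmetry. apply (is_lim_seq_incr_1 (fun n => Cmod (u n - l))).
Qed.

Lemma Clim_Cmod (u : nat -> C) (l : C) :
  Clim u l -> is_lim_seq (fun n => Cmod (u n)) (Cmod l).
Proof.
  intros Hu. apply is_lim_seq_spec; intros [e He]; simpl.
  destruct (proj1 (Clim_eps u l) Hu e He) as [N HN]; exists N; intros n Hn.
  specialize (HN n Hn).
  pose proof (Cmod_triangle (u n - l) l) as H1.
  pose proof (Cmod_triangle (- (u n - l)) (u n)) as H2. rewrite Cmod_opp in H2.
  replace (u n - l + l)%C with (u n) in H1 by ring.
  replace (- (u n - l) + u n)%C with l in H2 by ring.
  apply Rabs_def1; lra.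
Qed.

Lemma Clim_Cmod_le (u : nat -> C) (l : C) (B : R) :
  Clim u l -> (forall n, (Cmod (u n) <= B)%R) -> (Cmod l <= B)%R.
Proof.
  intros Hu HB.
  apply (is_lim_seq_le (fun n => Cmod (u n)) (fun _ => B) (Cmod l) B); auto.
  - now apply Clim_Cmod.
  - apply is_lim_seq_const.
Qed.

Lemma Clim_unique (u : nat -> C) (l m : C) : Clim u l -> Clim u m -> l = m.
Proof.
  intros Hl Hm.
  assert (H : Clim (fun n => u n + (- (1)) * u n)%C (l + (- (1)) * m)%C)
    by (apply Clim_plus; [|apply Clim_mult_l]; auto).
  assert (E : (Cmod (l + (- (1)) * m) <= 0)%R).
  { apply Clim_Cmod_le with (1 := H). intros n.
    replace (u n + - (1) * u n)%C with (RtoC 0) by ring. rewrite Cmod_0; lra. }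
  assert (E0 : (l + (- (1)) * m)%C = 0)
    by (apply Cmod_eq_0, Rle_antisym; auto using Cmod_ge_0).
  replace l with ((l + (- (1)) * m) + m)%C by ring. rewrite E0; ring.
Qed.

(** * Partial sums and absolute convergence *)

Definition Csum (u : nat -> C) (n : nat) : C := sum_n u n.

Lemma Csum_0 (u : nat -> C) : Csum u 0 = u 0%nat.
Proof. apply sum_O. Qed.

Lemma Csum_S (u : nat -> C) n : Csum u (S n) = (Csum u n + u (S n))%C.
Proof. apply (sum_Sn u n). Qed.

Lemma Rsum_0 (u : nat -> R) : sum_f_R0 u 0 = u 0%nat.
Proof. reflexivity. Qed.

Lemma Csum_ext (u v : nat -> C) n : (forall k, u k = v k) -> Csum u n = Csum v n.
Proof. intros H; now apply sum_n_ext. Qed.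

Lemma Csum_plus (u v : nat -> C) n :
  Csum (fun k => u k + v k)%C n = (Csum u n + Csum v n)%C.
Proof. apply (sum_n_plus u v n). Qed.

Lemma Csum_mult_l (c : C) (u : nat -> C) n :
  Csum (fun k => c * u k)%C n = (c * Csum u n)%C.
Proof. induction n; [now rewrite !Csum_0|]. rewrite !Csum_S, IHn; ring. Qed.

Lemma Rsum_mult_l (c : R) (u : nat -> R) n :
  sum_f_R0 (fun k => c * u k)%R n = (c * sum_f_R0 u n)%R.
Proof. induction n; [now rewrite !Rsum_0|]. rewrite !tech5, IHn; ring. Qed.

Lemma Csum_decr (u : nat -> C) n :
  Csum u (S n) = (u 0%nat + Csum (fun k => u (S k)) n)%C.
Proof.
  induction n; [now rewrite Csum_S, !Csum_0|].
  rewrite Csum_S, IHn, Csum_S; ring.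
Qed.

Lemma Rsum_decr (u : nat -> R) n :
  sum_f_R0 u (S n) = (u 0%nat + sum_f_R0 (fun k => u (S k)) n)%R.
Proof.
  induction n; [now rewrite tech5, !Rsum_0|].
  rewrite tech5, IHn, tech5; ring.
Qed.

Lemma Rsum_le (u v : nat -> R) n :
  (forall k, (u k <= v k)%R) -> (sum_f_R0 u n <= sum_f_R0 v n)%R.
Proof.
  intros H; induction n; [now rewrite !Rsum_0|].
  rewrite !tech5. now apply Rplus_le_compat.
Qed.

Lemma Rsum_ge_term (u : nat -> R) n :
  (forall k, (0 <= u k)%R) -> (u n <= sum_f_R0 u n)%R.
Proof.
  intros H. destruct n; [rewrite Rsum_0; lra|]. rewrite tech5.
  enough (0 <= sum_f_R0 u n)%R by lra.
  clear -H; induction n; [now rewrite Rsum_0|]. rewrite tech5; specialize (H (S n)); lra.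
Qed.

Lemma Cmod_sum (u : nat -> C) n :
  (Cmod (Csum u n) <= sum_f_R0 (fun k => Cmod (u k)) n)%R.
Proof.
  induction n; [rewrite Csum_0, Rsum_0; lra|]. rewrite Csum_S, tech5.
  eapply Rle_trans; [apply Cmod_triangle|]; lra.
Qed.

Lemma is_lim_sum (u : nat -> nat -> R) (l : nat -> R) N :
  (forall k, is_lim_seq (fun n => u n k) (l k)) ->
  is_lim_seq (fun n => sum_f_R0 (u n) N) (sum_f_R0 l N).
Proof.
  intros H; induction N.
  - rewrite Rsum_0. apply is_lim_seq_ext with (2 := H 0%nat). intros n; now rewrite Rsum_0.
  - rewrite tech5. apply is_lim_seq_ext with (2 := is_lim_seq_plus' _ _ _ _ IHN (H (S N))).
    intros n; now rewrite tech5.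
Qed.

Lemma bounded_sum_cv (u : nat -> R) (B : R) :
  (forall k, (0 <= u k)%R) -> (forall n, (sum_f_R0 u n <= B)%R) ->
  exists L : R, is_lim_seq (sum_f_R0 u) L /\ (L <= B)%R /\ (forall n, (sum_f_R0 u n <= L)%R).
Proof.
  intros H0 HB.
  assert (Hi : forall n, (sum_f_R0 u n <= sum_f_R0 u (S n))%R)
    by (intros n; rewrite tech5; specialize (H0 (S n)); lra).
  destruct (ex_finite_lim_seq_incr (sum_f_R0 u) B Hi HB) as [L HL].
  exists L; split; [exact HL|]; split.
  - apply (is_lim_seq_le (sum_f_R0 u) (fun _ => B) L B HB HL), is_lim_seq_const.
  - now apply is_lim_seq_incr_compare.
Qed.

Lemma Cmod_le_Re_Im (z : C) : (Cmod z <= Rabs (Re z) + Rabs (Im z))%R.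
Proof.
  replace z with (RtoC (Re z) + RtoC (Im z) * Ci)%C at 1
    by (apply injective_projections; simpl; unfold Re, Im; ring).
  eapply Rle_trans; [apply Cmod_triangle|].
  rewrite Cmod_mult, Cmod_Ci, !Cmod_R; lra.
Qed.

(** Completeness is reduced to the real line: real and imaginary parts are additive and dominated by
    the modulus, so both series converge absolutely. *)
Lemma abs_sum_cv (u : nat -> C) (B : R) :
  (forall n, (sum_f_R0 (fun k => Cmod (u k)) n <= B)%R) -> exists l, Clim (Csum u) l.
Proof.
  intros HB.
  destruct (bounded_sum_cv (fun k => Cmod (u k)) B) as [L [HL _]];
    auto using Cmod_ge_0.
  assert (Hc : forall p : C -> R, (forall x y, p (x + y)%C = (p x + p y)%R) ->
    (forall x, (Rabs (p x) <= Cmod x)%R) ->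
    exists l : R, is_lim_seq (fun n => p (Csum u n)) l).
  { intros p Hp Hle.
    assert (Hex : ex_series (V := R_CompleteNormedModule) (fun k => p (u k))).
    { apply (ex_series_le (V := R_CompleteNormedModule)) with (fun k => Cmod (u k)).
      - intros n; apply Hle.
      - exists L. apply is_lim_seq_ext with (2 := HL).
        intros n; symmetry; apply sum_n_Reals. }
    destruct Hex as [l Hl]. exists l.
    apply is_lim_seq_ext with (2 := Hl).
    intros n; rewrite sum_n_Reals; induction n; [now rewrite Csum_0|].
    now rewrite Csum_S, tech5, Hp, IHn. }
  destruct (Hc Re) as [x Hx]; [reflexivity|apply re_le_Cmod|].
  destruct (Hc Im) as [y Hy]; [reflexivity| |].
  { intros z. eapply Rle_trans; [apply Rmax_r|apply Rmax_Cmod]. }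
  exists (x, y).
  apply Clim_dominated with
    (fun n => Rabs (Re (Csum u n) - x) + Rabs (Im (Csum u n) - y))%R.
  - intros n. exact (Cmod_le_Re_Im (Csum u n - (x, y))%C).
  - replace (Finite 0) with (Finite (Rabs (x - x) + Rabs (y - y)))
      by (rewrite !Rminus_diag, Rabs_R0; f_equal; ring).
    apply is_lim_seq_plus'; apply (is_lim_seq_abs _ (Finite _));
      apply is_lim_seq_minus'; auto; apply is_lim_seq_const.
Qed.

(** * The Wiener algebra of a closed disc *)

(** Bounding all partial sums by [B] avoids naming the norm itself: any upper bound is allowed, and
    the operations below act on such bounds by plain arithmetic. *)
Definition expands (s B : R) (a : nat -> C) (F : C -> C) : Prop :=
  (forall N, (sum_f_R0 (fun m => Cmod (a m) * s ^ m) N <= B)%R) /\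
  forall t : C, (Cmod t <= s)%R -> Clim (Csum (fun m => a m * t ^ m)%C) (F t).

(* On the closed disc of radius [s] about 0, [F] is the sum of a power series whose norm
   in the weighted l^1 Banach algebra [{a | sum |a_m| s^m < oo}] is at most [B]. *)
Definition wiener (s B : R) (F : C -> C) : Prop :=
  (0 < s)%R /\ exists a, expands s B a F.

Lemma wiener_ext (s B : R) (F G : C -> C) :
  (forall t, (Cmod t <= s)%R -> F t = G t) -> wiener s B F -> wiener s B G.
Proof.
  intros H [Hs [a [Ha HF]]]; split; auto; exists a; split; auto.
  intros t Ht; rewrite <- H; auto.
Qed.

Lemma wiener_le (s s' B B' : R) (F : C -> C) :
  (0 < s' <= s)%R -> (B <= B')%R -> wiener s B F -> wiener s' B' F.
Proof.
  intros Hs HB [_ [a [Ha HF]]]; split; [lra|]; exists a; split.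
  - intros N; specialize (Ha N). eapply Rle_trans; [|apply HB]. eapply Rle_trans; [|apply Ha].
    apply Rsum_le; intros k. apply Rmult_le_compat_l; [apply Cmod_ge_0|].
    apply pow_incr; lra.
  - intros t Ht; apply HF; lra.
Qed.

Lemma wiener_ge0 (s B : R) (F : C -> C) : wiener s B F -> (0 <= B)%R.
Proof.
  intros [Hs [a [Ha _]]]. specialize (Ha 0%nat). rewrite Rsum_0 in Ha; simpl in Ha.
  pose proof (Cmod_ge_0 (a 0%nat)); lra.
Qed.

Lemma Cmod_sum_pow_le (a : nat -> C) (t : C) (s : R) N :
  (Cmod t <= s)%R ->
  (Cmod (Csum (fun m => a m * t ^ m)%C N) <= sum_f_R0 (fun m => Cmod (a m) * s ^ m) N)%R.
Proof.
  intros Ht. eapply Rle_trans; [apply Cmod_sum|]. apply Rsum_le; intros k.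
  rewrite Cmod_mult, Cmod_pow. apply Rmult_le_compat_l; [apply Cmod_ge_0|].
  apply pow_incr; split; auto using Cmod_ge_0.
Qed.

Lemma wiener_bound (s B : R) (F : C -> C) (t : C) :
  wiener s B F -> (Cmod t <= s)%R -> (Cmod (F t) <= B)%R.
Proof.
  intros [Hs [a [Ha HF]]] Ht. apply Clim_Cmod_le with (1 := HF t Ht).
  intros n. eapply Rle_trans; [now apply Cmod_sum_pow_le with (s := s)|apply Ha].
Qed.

Lemma wiener_plus (s B B' : R) (F G : C -> C) :
  wiener s B F -> wiener s B' G -> wiener s (B + B') (fun t => F t + G t)%C.
Proof.
  intros [Hs [a [Ha HF]]] [_ [b [Hb HG]]]; split; auto.
  exists (fun m => a m + b m)%C; split.
  - intros N. eapply Rle_trans; [|apply Rplus_le_compat; [apply (Ha N)|apply (Hb N)]].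
    rewrite <- sum_plus. apply Rsum_le; intros k.
    rewrite <- Rmult_plus_distr_r. apply Rmult_le_compat_r; [apply pow_le; lra|].
    apply Cmod_triangle.
  - intros t Ht. apply Clim_ext with (2 := Clim_plus _ _ _ _ (HF t Ht) (HG t Ht)).
    intros n. rewrite <- Csum_plus. apply Csum_ext; intros k. ring.
Qed.

Lemma wiener_scal (s B : R) (c : C) (F : C -> C) :
  wiener s B F -> wiener s (Cmod c * B) (fun t => c * F t)%C.
Proof.
  intros [Hs [a [Ha HF]]]; split; auto.
  exists (fun m => c * a m)%C; split.
  - intros N. eapply Rle_trans; [|apply Rmult_le_compat_l; [apply Cmod_ge_0|apply (Ha N)]].
    rewrite <- Rsum_mult_l. right; apply sum_eq; intros k _.
    rewrite Cmod_mult; ring.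
  - intros t Ht. apply Clim_ext with (2 := Clim_mult_l c _ _ (HF t Ht)).
    intros n. rewrite <- Csum_mult_l. apply Csum_ext; intros k. ring.
Qed.

Lemma wiener_const (s : R) (c : C) : (0 < s)%R -> wiener s (Cmod c) (fun _ => c).
Proof.
  intros Hs; split; auto. exists (fun m => match m with 0%nat => c | _ => 0 end); split.
  - intros N. destruct N; [rewrite Rsum_0; simpl; lra|]. rewrite Rsum_decr.
    rewrite (sum_eq _ (fun _ => 0%R)), sum_cte; [simpl; lra|].
    intros; rewrite Cmod_0; ring.
  - intros t _. apply Clim_ext with (2 := Clim_const c).
    intros n; induction n; [rewrite Csum_0; simpl; ring|]. rewrite Csum_S, <- IHn; ring.
Qed.

Lemma wiener_shift (s B : R) (F : C -> C) :
  wiener s B F -> wiener s (s * B) (fun t => t * F t)%C.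
Proof.
  intros [Hs [a [Ha HF]]]; split; auto.
  exists (fun m => match m with 0%nat => RtoC 0 | S m => a m end); split.
  - intros N.
    assert (HB : (0 <= s * B)%R)
      by (apply Rmult_le_pos; [lra|apply wiener_ge0 with s F; split; [|exists a; split]; auto]).
    destruct N; [rewrite Rsum_0, Cmod_0; simpl; lra|].
    rewrite Rsum_decr, Cmod_0, Rmult_0_l, Rplus_0_l.
    eapply Rle_trans; [|apply Rmult_le_compat_l; [lra|apply (Ha N)]].
    rewrite <- Rsum_mult_l. right; apply sum_eq; intros k _. simpl; ring.
  - intros t Ht. apply Clim_incr_1.
    apply Clim_ext with (2 := Clim_mult_l t _ _ (HF t Ht)).
    intros n. rewrite Csum_decr, <- Csum_mult_l, Cmult_0_l, Cplus_0_l.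
    apply Csum_ext; intros k. rewrite Cpow_S; ring.
Qed.

(* Interchanging the order of summation in an absolutely convergent double series:
   everything else about the algebra structure follows from this. *)
Lemma wiener_series (s B : R) (b : nat -> R) (f : nat -> C -> C) (F : C -> C) :
  (forall n, wiener s (b n) (f n)) -> (forall N, (sum_f_R0 b N <= B)%R) ->
  (forall t, (Cmod t <= s)%R -> Clim (Csum (fun n => f n t)) (F t)) ->
  wiener s B F.
Proof.
  intros Hf HB HF.
  assert (Hs : (0 < s)%R) by apply (Hf 0%nat).
  assert (Hb : forall n, (0 <= b n)%R) by (intros n; now apply wiener_ge0 with s (f n)).
  destruct (choice (fun n a =>
    (forall N, (sum_f_R0 (fun m => Cmod (a m) * s ^ m) N <= b n)%R) /\
    forall t : C, (Cmod t <= s)%R -> Clim (Csum (fun m => a m * t ^ m)%C) (f n t)))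
    as [c Hc]; [intros n; apply (Hf n)|].
  assert (Hpow : forall m, (0 < s ^ m)%R) by (intros m; now apply pow_lt).
  destruct (bounded_sum_cv b B Hb HB) as [L [HL [HLB HLn]]].
  (* Row [n] holds the coefficients of [f n]; the columns converge because [|c n m| s^m] is at most
     [b n]. *)
  assert (Hcol : forall m, exists d, Clim (Csum (fun n => c n m)) d).
  { intros m. apply abs_sum_cv with (B / s ^ m)%R. intros N.
    apply Rmult_le_reg_r with (1 := Hpow m). unfold Rdiv.
    rewrite Rmult_assoc, Rinv_l, Rmult_1_r by (specialize (Hpow m); lra).
    eapply Rle_trans; [|apply (HB N)]. rewrite Rmult_comm, <- Rsum_mult_l.
    apply Rsum_le; intros n. eapply Rle_trans; [|apply (proj1 (Hc n) m)].
    rewrite Rmult_comm. apply (Rsum_ge_term (fun m => Cmod (c n m) * s ^ m)%R).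
    intros k; apply Rmult_le_pos; [apply Cmod_ge_0|now apply Rlt_le]. }
  apply choice in Hcol; destruct Hcol as [d Hd].
  (* Dropping the rows after [N] costs at most the tail of [b] in norm. This is shown for finitely
     many rows and passed to the limit in [j]. *)
  assert (Htail : forall M N, (sum_f_R0 (fun m =>
    Cmod (d m - Csum (fun n => c n m) N) * s ^ m) M <= L - sum_f_R0 b N)%R).
  { intros M N.
    assert (Hj : forall j, (sum_f_R0 (fun m =>
      Cmod (Csum (fun n => c n m) (j + N) - Csum (fun n => c n m) N) * s ^ m) M
      <= sum_f_R0 b (j + N) - sum_f_R0 b N)%R).
    { induction j as [|j IH].
      - simpl. right. rewrite Rminus_diag, (sum_eq _ (fun _ => 0%R)), sum_cte; [ring|].
        intros; replace (Csum (fun n => c n i) N - Csum (fun n => c n i) N)%C with (RtoC 0) by ring.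
        rewrite Cmod_0; ring.
      - change (S j + N)%nat with (S (j + N)); rewrite tech5.
        apply Rle_trans with (sum_f_R0 (fun m =>
          Cmod (Csum (fun n => c n m) (j + N) - Csum (fun n => c n m) N) * s ^ m) M +
          sum_f_R0 (fun m => Cmod (c (S (j + N)) m) * s ^ m) M)%R.
        + rewrite <- sum_plus. apply Rsum_le; intros m. rewrite Csum_S, <- Rmult_plus_distr_r.
          apply Rmult_le_compat_r; [now apply Rlt_le|].
          eapply Rle_trans; [|apply Cmod_triangle]. right; f_equal; ring.
        + pose proof (proj1 (Hc (S (j + N))) M). lra. }
    apply (is_lim_seq_le
      (fun j => sum_f_R0 (fun m =>
         Cmod (Csum (fun n => c n m) (j + N) - Csum (fun n => c n m) N) * s ^ m) M)
      (fun _ => L - sum_f_R0 b N)%R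
      (Finite (sum_f_R0 (fun m => Cmod (d m - Csum (fun n => c n m) N) * s ^ m) M)%R)
      (Finite (L - sum_f_R0 b N))).
    - intros j. eapply Rle_trans; [apply Hj|]. specialize (HLn (j + N)%nat); lra.
    - apply (is_lim_sum (fun j m =>
        Cmod (Csum (fun n => c n m) (j + N) - Csum (fun n => c n m) N) * s ^ m)%R).
      intros m. apply (is_lim_seq_scal_r _ (s ^ m) (Finite _)).
      apply Clim_Cmod. apply (Clim_plus _ (fun _ => - _)%C); [|apply Clim_const].
      apply -> (is_lim_seq_incr_n (fun j => Cmod (Csum (fun n => c n m) j - d m)) N).
      apply Hd.
    - apply is_lim_seq_const. }
  split; auto. exists d; split.
  - intros M. apply Rle_trans with L; [|exact HLB].
    apply Rle_trans with (sum_f_R0 (fun m => Cmod (d m - Csum (fun n => c n m) 0) * s ^ m) M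
       + sum_f_R0 (fun m => Cmod (c 0%nat m) * s ^ m) M)%R.
    + rewrite <- sum_plus. apply Rsum_le; intros m. rewrite Csum_0, <- Rmult_plus_distr_r.
      apply Rmult_le_compat_r; [now apply Rlt_le|].
      eapply Rle_trans; [|apply Cmod_triangle]. right; f_equal; ring.
    + pose proof (Htail M 0%nat) as H1. rewrite Rsum_0 in H1.
      pose proof (proj1 (Hc 0%nat) M). lra.
  - intros t Ht. apply Clim_eps; intros e He.
    apply is_lim_seq_spec in HL.
    (* One third each for the rows beyond [N], for cutting the rows up to [N] at degree [M], and for
       stopping the series of [f n t] at [N]. *)
    assert (He3 : (0 < e / 3)%R) by lra.
    destruct (HL (mkposreal _ He3)) as [N1 HN1]; simpl in HN1.
    destruct (proj1 (Clim_eps _ _) (HF t Ht) _ He3) as [N2 HN2].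
    set (N := max N1 N2).
    specialize (HN1 N ltac:(lia)). specialize (HN2 N ltac:(lia)).
    apply Rabs_def2 in HN1.
    assert (HN : Clim (Csum (fun m => Csum (fun n => c n m) N * t ^ m)%C)
                      (Csum (fun n => f n t) N)).
    { clearbody N. clear -Hc Ht. induction N as [|N IH].
      - rewrite Csum_0. apply Clim_ext with (2 := proj2 (Hc 0%nat) t Ht).
        intros n; apply Csum_ext; intros k; now rewrite Csum_0.
      - rewrite Csum_S. apply Clim_ext with (2 := Clim_plus _ _ _ _ IH (proj2 (Hc (S N)) t Ht)).
        intros n; rewrite <- Csum_plus; apply Csum_ext; intros k; rewrite Csum_S; ring. }
    destruct (proj1 (Clim_eps _ _) HN _ He3) as [M0 HM]. exists M0; intros M HMM.
    specialize (HM M HMM).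
    pose proof (Cmod_sum_pow_le (fun m => d m - Csum (fun n => c n m) N)%C t s M Ht) as H1.
    pose proof (Htail M N) as H2.
    set (X := Csum (fun n => f n t) N) in *.
    set (Y := Csum (fun m => Csum (fun n => c n m) N * t ^ m)%C M) in *.
    replace (Csum (fun m => d m * t ^ m)%C M - F t)%C with
      (Csum (fun m => (d m - Csum (fun n => c n m) N) * t ^ m)%C M + ((Y - X) + (X - F t)))%C.
    2:{ replace (Csum (fun m => d m * t ^ m)%C M) with
         (Csum (fun m => (d m - Csum (fun n => c n m) N) * t ^ m)%C M + Y)%C; [ring|].
        unfold Y; rewrite <- Csum_plus; apply Csum_ext; intros k; ring. }
    eapply Rle_lt_trans; [apply Cmod_triangle|].
    pose proof (Cmod_triangle (Y - X) (X - F t)). lra.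
Qed.

Lemma wiener_id (s : R) : (0 < s)%R -> wiener s s (fun t => t).
Proof.
  intros Hs. apply wiener_le with s (s * Cmod 1)%R; [lra|rewrite Cmod_1; lra|].
  apply wiener_ext with (fun t => t * 1)%C; [intros; ring|].
  now apply wiener_shift, wiener_const.
Qed.

Lemma wiener_pow_mult (s B : R) (F : C -> C) (n : nat) :
  wiener s B F -> wiener s (s ^ n * B) (fun t => t ^ n * F t)%C.
Proof.
  intros HF; induction n as [|n IH].
  - rewrite pow_O, Rmult_1_l. apply wiener_ext with (2 := HF); intros; simpl; ring.
  - replace (s ^ S n * B)%R with (s * (s ^ n * B))%R by (simpl; ring).
    apply wiener_ext with (2 := wiener_shift _ _ _ IH). intros; rewrite Cpow_S; ring.
Qed.

Lemma wiener_mult (s B B' : R) (F G : C -> C) :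
  wiener s B F -> wiener s B' G -> wiener s (B * B') (fun t => F t * G t)%C.
Proof.
  intros [Hs [a [Ha HF]]] HG.
  apply wiener_series with (fun n => Cmod (a n) * (s ^ n * B'))%R
    (fun n t => a n * (t ^ n * G t))%C.
  - intros n. now apply wiener_scal, wiener_pow_mult.
  - intros N. rewrite Rmult_comm.
    eapply Rle_trans;
      [|apply Rmult_le_compat_l; [apply wiener_ge0 with (1 := HG)|apply (Ha N)]].
    rewrite <- Rsum_mult_l. right; apply sum_eq; intros; ring.
  - intros t Ht. rewrite Cmult_comm.
    apply Clim_ext with (2 := Clim_mult_l (G t) _ _ (HF t Ht)).
    intros n; rewrite <- Csum_mult_l; apply Csum_ext; intros; ring.
Qed.

Lemma wiener_pow (s B : R) (F : C -> C) (n : nat) :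
  wiener s B F -> wiener s (B ^ n) (fun t => F t ^ n)%C.
Proof.
  intros HF; induction n as [|n IH].
  - rewrite pow_O, <- Cmod_1. apply (wiener_const s 1), HF.
  - simpl. apply wiener_ext with (2 := wiener_mult _ _ _ _ _ HF IH). reflexivity.
Qed.

(** The powers of [p] have norms at most [B'^n], and [B' <= r] keeps the sum of [|a n| B'^n] below
    [B]. It is the norm of [p], not merely its values, that is compared with [r]. *)
Lemma wiener_comp (r s B B' : R) (F p : C -> C) :
  wiener r B F -> wiener s B' p -> (B' <= r)%R -> wiener s B (fun t => F (p t)).
Proof.
  intros [Hr [a [Ha HF]]] Hp HB.
  apply wiener_series with (fun n => Cmod (a n) * B' ^ n)%R (fun n t => a n * p t ^ n)%C.
  - intros n. now apply wiener_scal, wiener_pow.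
  - intros N. eapply Rle_trans; [|apply (Ha N)]. apply Rsum_le; intros k.
    apply Rmult_le_compat_l; [apply Cmod_ge_0|]. apply pow_incr.
    split; auto. now apply wiener_ge0 with s p.
  - intros t Ht. apply HF. apply Rle_trans with B'; [|exact HB].
    now apply wiener_bound with s.
Qed.

Lemma Cmod_minus_sym (x y : C) : Cmod (x - y) = Cmod (y - x).
Proof. rewrite <- Cmod_opp. f_equal; ring. Qed.

Lemma Cmod_minus_ge (x y : C) : (Cmod x - Cmod y <= Cmod (x - y))%R.
Proof.
  pose proof (Cmod_triangle (x - y) y) as H.
  replace (x - y + y)%C with x in H by ring. lra.
Qed.

Lemma Csub_neq0 (x y : C) : x <> y -> (x - y)%C <> 0.
Proof.
  intros H E; apply H. replace x with (x - y + y)%C by ring. rewrite E; ring.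
Qed.

Lemma Cmod_lt_neq (x y : C) : (Cmod x < Cmod y)%R -> (y - x)%C <> 0.
Proof. intros H; apply Csub_neq0; intros E; rewrite E in H; lra. Qed.

(** Inverting [1 - X] for [X] of norm at most 1/2 is composition with this function; 2 is the sum of
    the powers of 1/2. *)
Lemma wiener_geometric : wiener (1 / 2) 2 (fun t => / (1 - t))%C.
Proof.
  assert (Hn : forall t : C, (Cmod t <= 1 / 2)%R -> (1 - t)%C <> 0)
    by (intros t Ht; apply Cmod_lt_neq; rewrite Cmod_1; lra).
  split; [lra|]. exists (fun _ => RtoC 1); split.
  - intros N.
    rewrite (sum_eq _ (fun m => (1 / 2) ^ m)%R) by (intros; rewrite Cmod_1; ring).
    rewrite tech3 by lra. assert (0 < (1 / 2) ^ S N)%R by (apply pow_lt; lra). lra.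
  - intros t Ht.
    assert (E : forall N, Csum (fun m => 1 * t ^ m)%C N = ((1 - t ^ S N) * / (1 - t))%C).
    { induction N as [|N IH]; [rewrite Csum_0; simpl; field; auto|].
      rewrite Csum_S, IH, !Cpow_S. field; auto. }
    apply Clim_dominated with (fun n => Cmod (/ (1 - t)) * (1 / 2) ^ S n)%R.
    + intros n; rewrite E.
      replace ((1 - t ^ S n) * / (1 - t) - / (1 - t))%C with (/ (1 - t) * (- t ^ S n))%C by ring.
      rewrite Cmod_mult, Cmod_opp, Cmod_pow. apply Rmult_le_compat_l; [apply Cmod_ge_0|].
      apply pow_incr; split; [apply Cmod_ge_0|exact Ht].
    + replace (Finite 0) with (Rbar_mult (Cmod (/ (1 - t))) 0) by (simpl; f_equal; ring).
      apply is_lim_seq_scal_l, (is_lim_seq_incr_1 (fun n => (1 / 2) ^ n)%R).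
      apply is_lim_seq_geom. rewrite Rabs_pos_eq; lra.
Qed.

(** * Order of vanishing and local extrema of the modulus *)

Lemma Csum_at_0 (a : nat -> C) N : Csum (fun m => a m * 0 ^ m)%C N = a 0%nat.
Proof.
  induction N; [rewrite Csum_0; simpl; ring|]. rewrite Csum_S, IHN, Cpow_S; ring.
Qed.

Lemma expands_at_0 (s B : R) (a : nat -> C) (F : C -> C) :
  (0 < s)%R -> expands s B a F -> F 0 = a 0%nat.
Proof.
  intros Hs [_ HF]. apply Clim_unique with (Csum (fun m => a m * 0 ^ m)%C).
  - apply HF. rewrite Cmod_0; lra.
  - apply Clim_ext with (2 := Clim_const (a 0%nat)). intros n; now rewrite Csum_at_0.
Qed.

(** The coefficients are shifted by one. Off 0, [G] is the difference quotient itself, so the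
    factorization holds for every [t], even where the series says nothing; at 0 the value has to be
    [a 1]. *)
Lemma expands_factor (s B : R) (a : nat -> C) (F : C -> C) :
  (0 < s)%R -> expands s B a F ->
  exists G, expands s (B / s) (fun m => a (S m)) G /\ forall t, F t = (F 0 + t * G t)%C.
Proof.
  intros Hs HE. pose proof (expands_at_0 _ _ _ _ Hs HE) as H0. destruct HE as [Ha HF].
  set (G := fun t : C => if excluded_middle_informative (t = 0) then a 1%nat
                   else ((F t - F 0) / t)%C).
  exists G; split; [split|].
  - intros N. specialize (Ha (S N)). rewrite Rsum_decr in Ha.
    apply Rmult_le_reg_l with (1 := Hs).
    replace (s * (B / s))%R with B by (field; lra).
    rewrite <- Rsum_mult_l.
    rewrite (sum_eq _ (fun m => Cmod (a (S m)) * s ^ S m)%R) by (intros; simpl; ring).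
    pose proof (Cmod_ge_0 (a 0%nat)). rewrite pow_O in Ha; lra.
  - intros t Ht; unfold G. destruct (excluded_middle_informative (t = 0)) as [->|Ht0].
    + apply Clim_ext with (2 := Clim_const (a 1%nat)).
      intros n; now rewrite Csum_at_0.
    + rewrite H0. unfold Cdiv; rewrite Cmult_comm.
      replace (F t - a 0%nat)%C with (- a 0%nat + F t)%C by ring.
      apply Clim_ext with (2 := Clim_mult_l (/ t)%C _ _
        (Clim_plus _ _ _ _ (Clim_const _) (proj2 (Clim_incr_1 _ _) (HF t Ht)))).
      intros n. rewrite Csum_decr.
      rewrite (Csum_ext (fun k => a (S k) * t ^ S k)%C (fun k => t * (a (S k) * t ^ k))%C)
        by (intros; rewrite Cpow_S; ring).
      rewrite Csum_mult_l; simpl. field; auto.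
  - intros t; unfold G. destruct (excluded_middle_informative (t = 0)) as [->|Ht0]; [ring|].
    field; auto.
Qed.

Lemma wiener_factor (s B : R) (F : C -> C) :
  wiener s B F ->
  exists G, wiener s (B / s) G /\ forall t, F t = (F 0 + t * G t)%C.
Proof.
  intros [Hs [a HF]]. destruct (expands_factor s B a F Hs HF) as [G [HG E]].
  exists G; split; [|exact E]. split; [exact Hs|]. now exists (fun m => a (S m)).
Qed.

Lemma wiener_continuous_0 (s B e : R) (F : C -> C) :
  wiener s B F -> (0 < e)%R ->
  exists d, (0 < d <= s)%R /\ forall t, (Cmod t <= d)%R -> (Cmod (F t - F 0) < e)%R.
Proof.
  intros HF He. destruct (wiener_factor _ _ _ HF) as [G [HG E]].
  assert (Hs : (0 < s)%R) by apply HF. pose proof (wiener_ge0 _ _ _ HG) as HB.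
  assert (HB1 : (0 < B / s + 1)%R) by lra.
  exists (Rmin s (e / 2 / (B / s + 1))). split.
  - split; [apply Rmin_glb_lt; auto; apply Rdiv_lt_0_compat; lra|apply Rmin_l].
  - intros t Ht.
    pose proof (Rle_trans _ _ _ Ht (Rmin_l _ _)) as H1.
    pose proof (Rle_trans _ _ _ Ht (Rmin_r _ _)) as H2.
    rewrite E. replace (F 0 + t * G t - F 0)%C with (t * G t)%C by ring.
    rewrite Cmod_mult. pose proof (wiener_bound _ _ _ _ HG H1) as H3.
    apply Rle_lt_trans with (e / 2 / (B / s + 1) * (B / s + 1))%R.
    + apply Rmult_le_compat; auto using Cmod_ge_0; lra.
    + unfold Rdiv at 1. rewrite Rmult_assoc, Rinv_l; lra.
Qed.

(** A function vanishing at 0 is [t G t], whose norm on radius [s] carries a factor [s]. It can thus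
    be made as small as substitution and inversion require. *)
Lemma wiener_shrink (r s B : R) (F : C -> C) :
  wiener r B F -> F 0 = 0 -> (0 < s <= r)%R -> wiener s (s * (B / r)) F.
Proof.
  intros HF H0 Hs. destruct (wiener_factor _ _ _ HF) as [G [HG E]].
  apply wiener_ext with (fun t => t * G t)%C.
  - intros t _; rewrite E, H0; ring.
  - apply wiener_shift. apply wiener_le with r (B / r)%R; auto; lra.
Qed.

Lemma wiener_shrink_to (r B e : R) (F : C -> C) :
  wiener r B F -> F 0 = 0 -> (0 < e)%R -> exists s, (0 < s <= r)%R /\ wiener s e F.
Proof.
  intros HF H0 He. assert (Hr : (0 < r)%R) by apply HF. pose proof (wiener_ge0 _ _ _ HF) as HB.
  set (s := Rmin r (e * (r / (B + 1)))).
  assert (Hq : (0 < r / (B + 1))%R) by (apply Rdiv_lt_0_compat; lra).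
  assert (Hs : (0 < s <= r)%R).
  { unfold s; split; [|apply Rmin_l]. apply Rmin_glb_lt; auto. now apply Rmult_lt_0_compat. }
  exists s; split; auto. apply wiener_le with s (s * (B / r))%R; [lra| |now apply wiener_shrink].
  apply Rle_trans with (e * (r / (B + 1)) * ((B + 1) / r))%R.
  - apply Rmult_le_compat; [lra| |apply Rmin_r|].
    + apply Rmult_le_pos; auto. now apply Rlt_le, Rinv_0_lt_compat.
    + apply Rmult_le_compat_r; [now apply Rlt_le, Rinv_0_lt_compat|lra].
  - right; field; lra.
Qed.

Lemma wiener_order (s B : R) (F : C -> C) :
  wiener s B F ->
  (forall t, (Cmod t <= s)%R -> F t = 0) \/
  exists k G B', wiener s B' G /\ G 0 <> 0 /\
    forall t, (Cmod t <= s)%R -> F t = (t ^ k * G t)%C.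
Proof.
  intros [Hs [a HF]].
  destruct (excluded_middle_informative (forall n, a n = 0)) as [Ha|Ha].
  - left; intros t Ht. apply Clim_unique with (1 := proj2 HF t Ht).
    apply Clim_ext with (2 := Clim_const 0). intros n.
    rewrite (Csum_ext _ (fun k => 0 * t ^ k)%C) by (intros k; now rewrite Ha).
    rewrite Csum_mult_l; ring.
  - right. apply not_all_ex_not in Ha; destruct Ha as [n Hn].
    (* Induction on the index of some nonzero coefficient: as long as the constant term is 0, a
       factor [t] is split off and the index drops. *)
    revert a B F HF Hn; induction n as [|n IH]; intros a B F HF Hn.
    + exists 0%nat, F, B; split; [split; [exact Hs|now exists a]|]. split.
      * now rewrite (expands_at_0 _ _ _ _ Hs HF).
      * intros; simpl; ring.
    + destruct (excluded_middle_informative (a 0%nat = 0)) as [H0|H0].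
      * destruct (expands_factor _ _ _ _ Hs HF) as [G [HG EG]].
        destruct (IH _ _ _ HG Hn) as [k [G' [B' [H1 [H2 H3]]]]].
        exists (S k), G', B'; split; auto; split; auto. intros t Ht.
        rewrite EG, (expands_at_0 _ _ _ _ Hs HF), H0, H3, Cpow_S by auto; ring.
      * exists 0%nat, F, B; split; [split; [exact Hs|now exists a]|]. split.
        -- now rewrite (expands_at_0 _ _ _ _ Hs HF).
        -- intros; simpl; ring.
Qed.

Lemma wiener_away_0 (s B : R) (G : C -> C) :
  wiener s B G -> G 0 <> 0 ->
  exists d, (0 < d <= s)%R /\ forall t, (Cmod t <= d)%R -> (Cmod (G 0) / 2 <= Cmod (G t))%R.
Proof.
  intros HG H0. apply Cmod_gt_0 in H0.
  destruct (wiener_continuous_0 s B (Cmod (G 0) / 2) G HG) as [d [Hd H]]; [lra|].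
  exists d; split; auto. intros t Ht; specialize (H t Ht).
  rewrite Cmod_minus_sym in H. pose proof (Cmod_minus_ge (G 0) (G t)). lra.
Qed.

(** Neumann series: [1 / G] is [1 / G 0] times [1 / (1 - X)] with [X = 1 - G / G 0], and since
    [X 0 = 0] its norm drops to 1/2 on a smaller disc. *)
Lemma wiener_inv (s B : R) (G : C -> C) :
  wiener s B G -> G 0 <> 0 ->
  exists d B', (0 < d <= s)%R /\ wiener d B' (fun t => / G t)%C /\
    forall t, (Cmod t <= d)%R -> G t <> 0.
Proof.
  intros HG H0. assert (Hs : (0 < s)%R) by apply HG.
  set (X := fun t : C => (1 + (- / G 0) * G t)%C).
  assert (HX := wiener_plus _ _ _ _ _ (wiener_const s 1 Hs) (wiener_scal _ _ (- / G 0)%C _ HG)).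
  change (fun t : C => (1 + (- / G 0) * G t)%C) with X in HX.
  destruct (wiener_shrink_to _ _ (1 / 2) _ HX) as [d [Hd HXd]];
    [unfold X; field; auto|lra|].
  assert (HGX : forall t, (1 - X t)%C = (G t / G 0)%C) by (intros t; unfold X; field; auto).
  assert (Hnz : forall t, (Cmod t <= d)%R -> G t <> 0).
  { intros t Ht E. pose proof (wiener_bound _ _ _ _ HXd Ht) as Hb.
    unfold X in Hb; rewrite E in Hb.
    replace (1 + - / G 0 * 0)%C with (RtoC 1) in Hb by ring.
    rewrite Cmod_1 in Hb; lra. }
  exists d, (Cmod (/ G 0) * 2)%R; split; auto; split; auto.
  apply wiener_ext with (fun t => / G 0 * / (1 - X t))%C.
  - intros t Ht. rewrite HGX. specialize (Hnz t Ht). field; auto.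
  - apply wiener_scal. apply (wiener_comp (1 / 2) d 2 (1 / 2) _ X wiener_geometric HXd). lra.
Qed.

(** * Roots on the unit circle *)

Lemma de_moivre (x : R) (k : nat) :
  ((cos x, sin x) ^ k)%C = (cos (INR k * x), sin (INR k * x)).
Proof.
  induction k as [|k IH]; [simpl; rewrite Rmult_0_l, cos_0, sin_0; reflexivity|].
  rewrite Cpow_S, IH, S_INR, Rmult_plus_distr_r, Rmult_1_l, cos_plus, sin_plus.
  apply injective_projections; simpl; ring.
Qed.

Lemma Cmod_cos_sin (x : R) : Cmod (cos x, sin x) = 1%R.
Proof.
  unfold Cmod; simpl. transitivity (sqrt 1); [f_equal|apply sqrt_1].
  pose proof (sin2_cos2 x) as H; unfold Rsqr in H; lra.
Qed.

Lemma unit_root (v : C) (k : nat) :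
  Cmod v = 1%R -> (0 < k)%nat -> exists e : C, Cmod e = 1%R /\ (e ^ k)%C = v.
Proof.
  intros Hv Hk. destruct v as [x y].
  assert (Hxy : (x * x + y * y = 1)%R).
  { pose proof (Cmod2_alt (x, y)) as H. rewrite Hv in H; simpl in H; lra. }
  assert (Hx : (-1 <= x <= 1)%R) by nra.
  assert (Hth : exists th, cos th = x /\ sin th = y).
  { destruct (Rle_or_lt 0 y) as [Hy|Hy].
    - exists (acos x); split; [now apply cos_acos|]. rewrite sin_acos by auto.
      replace (1 - x²)%R with (y²)%R by (unfold Rsqr; lra). now apply sqrt_Rsqr.
    - exists (- acos x)%R; split; [rewrite cos_neg; now apply cos_acos|].
      rewrite sin_neg, sin_acos by auto.
      replace (1 - x²)%R with ((- y)²)%R by (unfold Rsqr; lra).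
      rewrite sqrt_Rsqr; lra. }
  destruct Hth as [th [<- <-]].
  exists (cos (th / INR k), sin (th / INR k)); split; [apply Cmod_cos_sin|].
  rewrite de_moivre. replace (INR k * (th / INR k))%R with th; auto.
  field. apply not_0_INR; lia.
Qed.

Lemma nontrivial_root_of_unity (k : nat) :
  (2 <= k)%nat -> exists e : C, Cmod e = 1%R /\ (e ^ k)%C = 1 /\ e <> 1.
Proof.
  intros Hk. set (x := (2 * PI / INR k)%R).
  assert (Hk2 : (2 <= INR k)%R) by now apply (le_INR 2).
  pose proof PI_RGT_0 as Hpi.
  assert (Hx : (0 < x <= PI)%R).
  { unfold x; split; [apply Rdiv_lt_0_compat; lra|].
    apply Rmult_le_reg_r with (INR k); [lra|].
    unfold Rdiv; rewrite Rmult_assoc, Rinv_l; [nra|lra]. }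
  exists (cos x, sin x); split; [apply Cmod_cos_sin|]; split.
  - rewrite de_moivre. replace (INR k * x)%R with (2 * PI)%R by (unfold x; field; lra).
    rewrite cos_2PI, sin_2PI; reflexivity.
  - intros E. apply (f_equal fst) in E; simpl in E.
    pose proof (cos_decreasing_1 0 x). rewrite cos_0 in *. lra.
Qed.

(* If [F = F 0 + t^k G] with [k > 0] and [G 0 <> 0], moving [t] in a direction where
   [t^k G 0] is a positive multiple of [F 0] increases the modulus. *)
Lemma wiener_local_max (s B : R) (F : C -> C) :
  wiener s B F -> (forall t, (Cmod t <= s)%R -> (Cmod (F t) <= Cmod (F 0))%R) ->
  forall t, (Cmod t <= s)%R -> F t = F 0.
Proof.
  intros HF Hmax. assert (Hs : (0 < s)%R) by apply HF.
  assert (HD : wiener s _ (fun t => F t + - F 0)%C)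
    by (apply wiener_plus; [exact HF|now apply wiener_const]).
  destruct (wiener_order _ _ _ HD) as [H|[k [G [B' [HG [HG0 E]]]]]].
  { intros t Ht. replace (F t) with ((F t + - F 0) + F 0)%C by ring. rewrite (H t Ht); ring. }
  exfalso.
  (* If [F 0 = 0], the maximum forces [F = 0], although [G] does not vanish near 0. *)
  assert (HF0 : F 0 <> 0).
  { intros HF0. assert (E1 : forall t, (Cmod t <= s)%R -> F t = 0).
    { intros t Ht. apply Cmod_eq_0, Rle_antisym; [|apply Cmod_ge_0].
      rewrite <- Cmod_0, <- HF0. auto. }
    destruct (wiener_away_0 _ _ _ HG HG0) as [d [Hd Hd']].
    assert (Hm : Cmod d = d) by (rewrite Cmod_R, Rabs_pos_eq; lra).
    specialize (E d ltac:(lra)). rewrite E1, HF0 in E by lra.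
    replace (0 + - 0)%C with (RtoC 0) in E by ring.
    apply Cmod_gt_0 in HG0. specialize (Hd' d ltac:(lra)).
    assert (Hp : (0 < Cmod (d ^ k * G d))%R).
    { rewrite Cmod_mult, Cmod_pow, Hm. apply Rmult_lt_0_compat; [apply pow_lt; lra|lra]. }
    rewrite <- E, Cmod_0 in Hp. lra. }
  assert (Hk : (0 < k)%nat).
  { destruct k; [|lia]. specialize (E 0). rewrite Cmod_0 in E. specialize (E ltac:(lra)).
    simpl in E. exfalso; apply HG0. replace (G 0) with (1 * G 0)%C by ring. rewrite <- E; ring. }
  apply Cmod_gt_0 in HF0. pose proof HG0 as HG0'. apply Cmod_gt_0 in HG0'.
  assert (HF0' : RtoC (Cmod (F 0)) <> 0) by (apply Cmod_gt_0; rewrite Cmod_R, Rabs_pos_eq; lra).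
  (* [v] has modulus 1 and [v G 0] is a positive multiple of [F 0]; a [k]-th root [e] of [v] is the
     direction of [t]. *)
  set (v := (Cmod (G 0) / Cmod (F 0) * (F 0 / G 0))%C).
  destruct (unit_root v k) as [e [He1 He2]]; auto.
  { unfold v. rewrite Cmod_mult, !Cmod_div, !Cmod_R, !Rabs_pos_eq by (auto; lra). field; lra. }
  (* With [|G t - G 0| < |G 0| / 2] the error stays below half of the gain [q |F 0| = d^k |G 0|]. *)
  destruct (wiener_continuous_0 s B' (Cmod (G 0) / 2) G HG) as [d [Hd Hd']]; [lra|].
  assert (Ht : Cmod (d * e) = d) by (rewrite Cmod_mult, He1, Cmod_R, Rabs_pos_eq; lra).
  specialize (Hmax (d * e)%C ltac:(lra)). specialize (Hd' (d * e)%C ltac:(lra)).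
  specialize (E (d * e)%C ltac:(lra)).
  assert (Hdk : (0 < d ^ k)%R) by (apply pow_lt; lra).
  set (q := (d ^ k * Cmod (G 0) / Cmod (F 0))%R).
  assert (Hq : (0 < q)%R) by (unfold q; apply Rdiv_lt_0_compat; nra).
  assert (E2 : F (d * e)%C = ((1 + q)%R * F 0 - - ((d * e) ^ k * (G (d * e) - G 0)))%C).
  { replace (F (d * e)%C) with (F 0 + (d * e) ^ k * G (d * e))%C by (rewrite <- E; ring).
    assert (E3 : ((d * e) ^ k * G 0 = q * F 0)%C).
    { rewrite Cpow_mult_l, He2. unfold v, q.
      rewrite RtoC_div, RtoC_mult, RtoC_pow by lra. field; auto. }
    rewrite RtoC_plus. replace (((1 + q) * F 0))%C with (F 0 + q * F 0)%C by ring.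
    rewrite <- E3. ring. }
  pose proof (Cmod_minus_ge ((1 + q)%R * F 0)%C (- ((d * e) ^ k * (G (d * e)%C - G 0)))%C) as H.
  rewrite <- E2, Cmod_opp, !Cmod_mult, Cmod_pow, Ht, Cmod_R, Rabs_pos_eq in H by lra.
  assert (q * Cmod (F 0) = d ^ k * Cmod (G 0))%R by (unfold q; field; lra).
  nra.
Qed.

Lemma wiener_local_min (s B : R) (F : C -> C) :
  wiener s B F -> F 0 <> 0 ->
  (forall t, (Cmod t <= s)%R -> (Cmod (F 0) <= Cmod (F t))%R) ->
  exists d, (0 < d <= s)%R /\ forall t, (Cmod t <= d)%R -> F t = F 0.
Proof.
  intros HF H0 Hmin. destruct (wiener_inv _ _ _ HF H0) as [d [B' [Hd [HI Hnz]]]].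
  exists d; split; auto. intros t Ht.
  assert (E : (/ F t = / F 0)%C).
  { apply (wiener_local_max d B' (fun t => / F t)%C HI); auto. intros u Hu.
    rewrite !Cmod_inv by auto. apply Cmod_gt_0 in H0.
    apply Rinv_le_contravar; auto. apply Hmin; lra. }
  specialize (Hnz t Ht). replace (F t) with (/ / F t)%C by (field; auto). rewrite E. field; auto.
Qed.

(** * Analytic functions on the unit disc *)

Lemma dval_inj (x y : unit_disc) : dval x = dval y -> x = y.
Proof.
  destruct x as [x Hx], y as [y Hy]; simpl; intros <-. f_equal; apply proof_irrelevance.
Qed.

(** Allows evaluation at a complex number such as [z0 + t] without carrying a proof that it lies in
    the disc; the value 0 outside is a placeholder. *)
Definition extend (f : unit_disc -> C) (z : C) : C :=
  match Rlt_dec (Cmod z) 1 with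
  | left h => f (mk_unit_disc z h)
  | right _ => 0
  end.

Lemma extend_dval (f : unit_disc -> C) (z : unit_disc) : extend f z = f z.
Proof.
  unfold extend. destruct (Rlt_dec (Cmod z) 1) as [h|h].
  - f_equal. now apply dval_inj.
  - destruct h; apply disc_lt1.
Qed.

Lemma is_pseries_Clim (a : nat -> C) (t l : C) :
  @is_pseries C_AbsRing C_NormedModule a t l <-> Clim (Csum (fun m => a m * t ^ m)%C) l.
Proof.
  unfold is_pseries, is_series.
  etransitivity; [apply (filterlim_locally_ball_norm (U := C_NormedModule))|].
  rewrite Clim_eps.
  assert (E : forall n, sum_n (fun k => scal (pow_n t k) (a k) : C_NormedModule) n
                        = Csum (fun m => a m * t ^ m)%C n).
  { intros n; apply Csum_ext; intros k.
    transitivity (Cmult (pow_n (K := C_AbsRing) t k) (a k)); [reflexivity|].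
    rewrite Cmult_comm. reflexivity. }
  split.
  - intros H e He. destruct (H (mkposreal e He)) as [N HN]; exists N; intros n Hn.
    specialize (HN n Hn). unfold ball_norm in HN. rewrite E in HN. exact HN.
  - intros H e. destruct (H e (cond_pos e)) as [N HN]; exists N; intros n Hn.
    unfold ball_norm. rewrite E. now apply HN.
Qed.

Definition wiener_at (f : unit_disc -> C) (z0 : unit_disc) : Prop :=
  exists r B F, wiener r B F /\
    forall z : unit_disc, (Cmod (z - z0) <= r)%R -> f z = F (z - z0)%C.

Lemma wiener_at_center f (F : C -> C) (r : R) (z0 : unit_disc) : (0 < r)%R ->
  (forall z : unit_disc, (Cmod (z - z0) <= r)%R -> f z = F (z - z0)%C) -> f z0 = F 0.
Proof. intros Hr H. rewrite H; rewrite Cminus_diag; [auto|rewrite Cmod_0; lra]. Qed.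

Lemma Clim_sum_bounded_terms (u : nat -> C) (l : C) :
  Clim (Csum u) l -> exists M, forall n, (Cmod (u n) <= M)%R.
Proof.
  intros H. destruct (maj_by_pos (fun n => Cmod (Csum u n))) as [K [HK Hb]].
  { exists (Cmod l). apply is_lim_seq_Reals. now apply Clim_Cmod. }
  assert (Hb' : forall n, (Cmod (Csum u n) <= K)%R)
    by (intros n; specialize (Hb n); rewrite Rabs_pos_eq in Hb; auto using Cmod_ge_0).
  exists (K + K)%R; intros [|n].
  - specialize (Hb' 0%nat); rewrite Csum_0 in Hb'; lra.
  - replace (u (S n)) with (Csum u (S n) + - Csum u n)%C by (rewrite Csum_S; ring).
    eapply Rle_trans; [apply Cmod_triangle|]. rewrite Cmod_opp.
    pose proof (Hb' n); pose proof (Hb' (S n)); lra.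
Qed.

(** Abel's lemma: convergence at [t = d] bounds [|a m| d^m] by some [M], so on radius [d / 2] the
    norm is at most [M] times the sum of the powers of 1/2. The radius [d] is such that [z0 + t]
    stays in the disc. *)
Lemma analytic_wiener (f : unit_disc -> C) : analytic f <-> forall z0, wiener_at f z0.
Proof.
  split; intros H z0.
  - destruct (H z0) as [a [r [Hr Ha]]]. pose proof (disc_lt1 z0) as H0.
    set (d := (Rmin r (1 - Cmod z0) / 2)%R).
    assert (Hd1 : (0 < Rmin r (1 - Cmod z0))%R) by (apply Rmin_glb_lt; lra).
    pose proof (Rmin_l r (1 - Cmod z0)) as Hd2. pose proof (Rmin_r r (1 - Cmod z0)) as Hd3.
    assert (Hin : forall t, (Cmod t <= d)%R ->
      Clim (Csum (fun m => a m * t ^ m)%C) (extend f (z0 + t)%C)).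
    { intros t Ht. unfold d in Ht.
      assert (h : (Cmod (z0 + t) < 1)%R) by (pose proof (Cmod_triangle z0 t); lra).
      apply is_pseries_Clim. specialize (Ha (mk_unit_disc _ h)); simpl in Ha.
      rewrite <- (extend_dval f) in Ha; simpl in Ha.
      replace (z0 + t - z0)%C with t in Ha by ring. apply Ha. lra. }
    assert (Hd : (0 < d)%R) by (unfold d; lra).
    assert (Hmd : Cmod d = d) by (rewrite Cmod_R, Rabs_pos_eq; lra).
    destruct (Clim_sum_bounded_terms _ _ (Hin d ltac:(lra))) as [M HM].
    exists (d / 2)%R, (M * 2)%R, (fun t => extend f (z0 + t)%C); split; [split; [lra|]|].
    + exists a; split; [|intros t Ht; apply Hin; lra]. intros N.
      assert (HM0 : (0 <= M)%R) by (eapply Rle_trans; [apply Cmod_ge_0|apply (HM 0%nat)]).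
      apply Rle_trans with (sum_f_R0 (fun m => M * (1 / 2) ^ m) N)%R.
      * apply Rsum_le; intros k. specialize (HM k).
        rewrite Cmod_mult, Cmod_pow, Hmd in HM.
        replace (d / 2)%R with (d * (1 / 2))%R by field. rewrite Rpow_mult_distr, <- Rmult_assoc.
        apply Rmult_le_compat_r; auto. apply pow_le; lra.
      * rewrite Rsum_mult_l. apply Rmult_le_compat_l; auto. rewrite tech3 by lra.
        assert (0 < (1 / 2) ^ S N)%R by (apply pow_lt; lra). lra.
    + intros z _. replace (z0 + (z - z0))%C with (dval z) by ring. now rewrite extend_dval.
  - destruct (H z0) as [r [B [F [[Hr [a [_ HF]]] E]]]]. exists a, r; split; auto.
    intros z Hz. apply is_pseries_Clim. rewrite E by lra. apply HF; lra.
Qed.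

Lemma wiener_at_plus f g z0 :
  wiener_at f z0 -> wiener_at g z0 -> wiener_at (fun z => f z + g z)%C z0.
Proof.
  intros [r [B [F [HF EF]]]] [r' [B' [G [HG EG]]]].
  assert (Hr : (0 < Rmin r r')%R) by (apply Rmin_glb_lt; [apply HF|apply HG]).
  pose proof (Rmin_l r r'); pose proof (Rmin_r r r').
  exists (Rmin r r'), (B + B')%R, (fun t => F t + G t)%C; split.
  - apply wiener_plus; [apply wiener_le with r B|apply wiener_le with r' B']; auto; lra.
  - intros z Hz. rewrite EF, EG by lra. reflexivity.
Qed.

Lemma wiener_at_mult f g z0 :
  wiener_at f z0 -> wiener_at g z0 -> wiener_at (fun z => f z * g z)%C z0.
Proof.
  intros [r [B [F [HF EF]]]] [r' [B' [G [HG EG]]]].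
  assert (Hr : (0 < Rmin r r')%R) by (apply Rmin_glb_lt; [apply HF|apply HG]).
  pose proof (Rmin_l r r'); pose proof (Rmin_r r r').
  exists (Rmin r r'), (B * B')%R, (fun t => F t * G t)%C; split.
  - apply wiener_mult; [apply wiener_le with r B|apply wiener_le with r' B']; auto; lra.
  - intros z Hz. rewrite EF, EG by lra. reflexivity.
Qed.

Lemma analytic_plus f g :
  analytic f -> analytic g -> analytic (fun z => f z + g z)%C.
Proof. rewrite !analytic_wiener; intros; now apply wiener_at_plus. Qed.

Lemma analytic_mult f g :
  analytic f -> analytic g -> analytic (fun z => f z * g z)%C.
Proof. rewrite !analytic_wiener; intros; now apply wiener_at_mult. Qed.

Lemma analytic_const c : analytic (fun _ => c).
Proof.
  apply analytic_wiener; intros z0. exists 1%R, (Cmod c), (fun _ => c); split; auto.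
  apply wiener_const; lra.
Qed.

Lemma analytic_id : analytic (fun z => dval z).
Proof.
  apply analytic_wiener; intros z0.
  exists 1%R, (Cmod z0 + 1)%R, (fun t => z0 + t)%C; split.
  - apply wiener_plus; [apply wiener_const|apply wiener_id]; lra.
  - intros; ring.
Qed.

Lemma analytic_ext f g : (forall z, f z = g z) -> analytic f -> analytic g.
Proof. intros H; replace g with f; auto. now apply functional_extensionality. Qed.

Lemma analytic_minus f g :
  analytic f -> analytic g -> analytic (fun z => f z - g z)%C.
Proof.
  intros Hf Hg. apply analytic_ext with (fun z => f z + (- (1)) * g z)%C; [intros; ring|].
  auto using analytic_plus, analytic_mult, analytic_const.
Qed.

Lemma analytic_pow f n : analytic f -> analytic (fun z => f z ^ n)%C.
Proof.
  intros Hf; induction n; [apply (analytic_const 1)|].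
  apply analytic_ext with (fun z => f z * f z ^ n)%C; auto using analytic_mult.
Qed.

(** The increment [phi - phi z0] vanishes at [z0], so on a small disc its norm is at most the radius
    [r] of the outer expansion, and substitution applies. *)
Lemma analytic_comp f (phi : unit_disc -> unit_disc) :
  analytic f -> analytic (fun z => dval (phi z)) -> analytic (fun z => f (phi z)).
Proof.
  rewrite !analytic_wiener; intros Hf Hphi z0.
  destruct (Hf (phi z0)) as [r [B [F [HF EF]]]].
  destruct (Hphi z0) as [r' [B' [P [HP EP]]]].
  assert (HP' := wiener_plus _ _ _ _ _ HP (wiener_const r' (- P 0)%C (proj1 HP))).
  assert (Hr : (0 < r)%R) by apply HF. assert (Hr' : (0 < r')%R) by apply HP.
  destruct (wiener_shrink_to _ _ r _ HP') as [s [Hs HPs]]; [ring|auto|].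
  exists s, B, (fun t => F (P t + - P 0)%C); split.
  - apply (wiener_comp r s B r F _ HF HPs). lra.
  - intros z Hz.
    assert (E0 : dval (phi z0) = P 0)
      by now apply (wiener_at_center (fun z => dval (phi z)) P r').
    assert (E : (phi z - phi z0)%C = (P (z - z0) + - P 0)%C)
      by (rewrite E0, EP by lra; reflexivity).
    rewrite EF; [now rewrite E|]. rewrite E. now apply (wiener_bound _ _ _ _ HPs).
Qed.

Lemma near_point (z0 : unit_disc) (d : R) :
  (0 < d)%R -> exists z : unit_disc, dval z <> z0 /\ (Cmod (z - z0) < d)%R.
Proof.
  intros Hd. pose proof (disc_lt1 z0) as H0.
  set (e := (Rmin d (1 - Cmod z0) / 2)%R).
  assert (He : (0 < Rmin d (1 - Cmod z0))%R) by (apply Rmin_glb_lt; lra).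
  pose proof (Rmin_l d (1 - Cmod z0)). pose proof (Rmin_r d (1 - Cmod z0)).
  assert (Hm : Cmod e = e) by (rewrite Cmod_R, Rabs_pos_eq; unfold e; lra).
  assert (h : (Cmod (z0 + e) < 1)%R) by (pose proof (Cmod_triangle z0 e); unfold e in *; lra).
  exists (mk_unit_disc _ h); simpl.
  replace (z0 + e - z0)%C with (RtoC e) by ring. rewrite Hm. split; [|unfold e; lra].
  intros E. assert (E' : RtoC e = 0) by (replace (RtoC e) with (z0 + e - z0)%C by ring;
    rewrite E; ring).
  rewrite E', Cmod_0 in Hm. unfold e in Hm; lra.
Qed.

(** * Isolated zeros, the identity theorem and extrema of the modulus *)

Lemma analytic_isolated_zeros f (z0 : unit_disc) : analytic f ->
  (exists d, (0 < d)%R /\ forall z : unit_disc, (Cmod (z - z0) < d)%R -> f z = 0) \/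
  exists k r B G, wiener r B G /\ G 0 <> 0 /\
    (forall z : unit_disc, (Cmod (z - z0) <= r)%R -> f z = ((z - z0) ^ k * G (z - z0))%C) /\
    forall z : unit_disc, (Cmod (z - z0) <= r)%R -> dval z <> z0 -> f z <> 0.
Proof.
  rewrite analytic_wiener; intros H. destruct (H z0) as [r [B [F [HF EF]]]].
  assert (Hr : (0 < r)%R) by apply HF.
  destruct (wiener_order _ _ _ HF) as [E|[k [G [B' [HG [HG0 E]]]]]].
  - left; exists r; split; auto. intros z Hz; rewrite EF, E by lra; reflexivity.
  - right. destruct (wiener_away_0 _ _ _ HG HG0) as [d [Hd Haway]].
    exists k, d, B', G. split; [apply wiener_le with r B'; auto; lra|]. split; auto.
    assert (E' : forall z : unit_disc, (Cmod (z - z0) <= d)%R ->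
      f z = ((z - z0) ^ k * G (z - z0))%C) by (intros; rewrite EF, E by lra; reflexivity).
    split; auto. intros z Hz Hne. rewrite E' by auto.
    apply Cmult_neq_0; [apply Cpow_nz; now apply Csub_neq0|].
    apply Cmod_gt_0. apply Cmod_gt_0 in HG0. specialize (Haway _ Hz). lra.
Qed.

Lemma analytic_continuous f (z0 : unit_disc) (e : R) : analytic f -> (0 < e)%R ->
  exists d, (0 < d)%R /\ forall z : unit_disc, (Cmod (z - z0) < d)%R -> (Cmod (f z - f z0) < e)%R.
Proof.
  rewrite analytic_wiener; intros H He. destruct (H z0) as [r [B [F [HF EF]]]].
  destruct (wiener_continuous_0 r B e F HF He) as [d [Hd Hc]].
  exists d; split; [apply Hd|]. intros z Hz.
  rewrite !EF; [|rewrite Cminus_diag, Cmod_0; lra|lra].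
  rewrite Cminus_diag. apply Hc; lra.
Qed.

Lemma disc_convex (z0 z1 : unit_disc) (t : R) :
  (0 <= t <= 1)%R -> (Cmod (z0 + t * (z1 - z0)) < 1)%R.
Proof.
  intros Ht. replace (z0 + t * (z1 - z0))%C with ((1 - t)%R * z0 + t * z1)%C
    by (rewrite RtoC_minus; ring).
  pose proof (disc_lt1 z0); pose proof (disc_lt1 z1).
  eapply Rle_lt_trans; [apply Cmod_triangle|].
  rewrite !Cmod_mult, !Cmod_R, !Rabs_pos_eq by lra.
  destruct (Req_dec t 0) as [->|]; [lra|]. nra.
Qed.

(* The zeros of [f] along the segment from [z0] to [z1]: at the first place where they
   stop, they would accumulate at a zero that is isolated. *)
Lemma analytic_identity f (z0 : unit_disc) (d0 : R) :
  analytic f -> (0 < d0)%R ->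
  (forall z : unit_disc, (Cmod (z - z0) < d0)%R -> f z = 0) -> forall z, f z = 0.
Proof.
  intros Hf Hd0 Hz0 z1.
  destruct (excluded_middle_informative (dval z1 = dval z0)) as [E01|N01].
  { apply Hz0. now rewrite E01, Cminus_diag, Cmod_0. }
  set (L := Cmod (z1 - z0)).
  assert (HL : (0 < L)%R) by (apply Cmod_gt_0, Csub_neq0; auto).
  set (gam := fun t : R => (z0 + t * (z1 - z0))%C).
  assert (Hgam : forall s t, Cmod (gam s - gam t) = (Rabs (s - t) * L)%R).
  { intros s t. unfold gam, L.
    replace (z0 + s * (z1 - z0) - (z0 + t * (z1 - z0)))%C with ((s - t)%R * (z1 - z0))%C
      by (rewrite RtoC_minus; ring).
    now rewrite Cmod_mult, Cmod_R. }
  assert (Hpt : forall t, (0 <= t <= 1)%R ->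
    exists z : unit_disc, dval z = gam t /\ extend f (gam t) = f z).
  { intros t Ht. exists (mk_unit_disc _ (disc_convex z0 z1 t Ht)); split; auto.
    now rewrite <- extend_dval. }
  set (E := fun t => (0 <= t <= 1)%R /\ forall s, (0 <= s <= t)%R -> extend f (gam s) = 0).
  assert (Hstart : forall s, (0 <= s <= 1)%R -> (s * L < d0)%R -> extend f (gam s) = 0).
  { intros s Hs Hsd. destruct (Hpt s Hs) as [z [Ez ->]]. apply Hz0.
    replace (dval z0) with (gam 0) by (unfold gam; ring).
    rewrite Ez, Hgam, Rminus_0_r, Rabs_pos_eq; lra. }
  destruct (completeness E) as [sg [Hub Hlub]].
  { exists 1%R; intros t [Ht _]; lra. }
  { exists 0%R; split; [lra|]. intros s Hs. apply Hstart; [lra|]. replace s with 0%R by lra. lra. }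
  assert (Hsg0 : (0 < sg)%R).
  { set (q := Rmin 1 (d0 / 2 / L)).
    assert (Hq : (0 < q)%R) by (apply Rmin_glb_lt; [lra|apply Rdiv_lt_0_compat; lra]).
    apply Rlt_le_trans with q; auto. apply Hub; split; [split; [lra|apply Rmin_l]|].
    intros s Hs. pose proof (Rmin_l 1 (d0 / 2 / L)). pose proof (Rmin_r 1 (d0 / 2 / L)).
    apply Hstart; [unfold q in *; lra|].
    apply Rle_lt_trans with (d0 / 2 / L * L)%R; [apply Rmult_le_compat_r; unfold q in *; lra|].
    replace (d0 / 2 / L * L)%R with (d0 / 2)%R by (field; lra). lra. }
  assert (Hsg1 : (sg <= 1)%R) by (apply Hlub; intros t [Ht _]; lra).
  assert (Hbelow : forall s, (0 <= s < sg)%R -> extend f (gam s) = 0).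
  { intros s Hs. apply NNPP; intros Hn.
    assert (is_upper_bound E s).
    { intros t [Ht HE]. destruct (Rle_or_lt t s); auto. exfalso; apply Hn, HE; lra. }
    specialize (Hlub s H). lra. }
  destruct (Hpt sg) as [z [Ez Efz]]; [lra|].
  destruct (analytic_isolated_zeros f z Hf) as [[d [Hd Hzero]]|[k [r [B [G [HG [_ [_ Hnz]]]]]]]].
  - set (q := (d / 2 / L)%R).
    assert (Hq : (0 < q)%R) by (unfold q; repeat apply Rdiv_lt_0_compat; lra).
    assert (Hqz : forall s, (0 <= s <= 1)%R -> (sg <= s <= sg + q)%R -> extend f (gam s) = 0).
    { intros s Hs Hsq. destruct (Hpt s Hs) as [y [Ey ->]]. apply Hzero.
      rewrite Ey, Ez, Hgam, Rabs_pos_eq by lra.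
      apply Rle_lt_trans with (q * L)%R; [apply Rmult_le_compat_r; lra|].
      unfold q; replace (d / 2 / L * L)%R with (d / 2)%R by (field; lra). lra. }
    assert (HE : E (Rmin 1 (sg + q))).
    { pose proof (Rmin_l 1 (sg + q)). pose proof (Rmin_r 1 (sg + q)).
      split; [split; auto; apply Rmin_glb; lra|]. intros s Hs.
      destruct (Rlt_or_le s sg); [apply Hbelow|apply Hqz]; lra. }
    (* A step beyond the supremum is absurd unless the parameter 1, that is [z1], has been
       reached. *)
    pose proof (Hub _ HE) as H. destruct (Rle_or_lt 1 (sg + q)) as [H1|H1].
    + rewrite <- extend_dval. replace (dval z1) with (gam 1) by (unfold gam; ring).
      apply HE. rewrite Rmin_left; lra.
    + rewrite Rmin_right in H; lra.
  - exfalso. assert (Hr : (0 < r)%R) by apply HG.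
    set (s := Rmax 0 (sg - r / L)).
    assert (Hrl : (0 < r / L)%R) by (apply Rdiv_lt_0_compat; lra).
    assert (Hs1 : (0 <= s)%R) by apply Rmax_l.
    assert (Hs2 : (sg - r / L <= s)%R) by apply Rmax_r.
    assert (Hs3 : (s < sg)%R) by (apply Rmax_lub_lt; lra).
    destruct (Hpt s) as [y [Ey Efy]]; [lra|].
    apply (Hnz y).
    + rewrite Ey, Ez, Hgam, Rabs_left1 by lra.
      apply Rle_trans with (r / L * L)%R; [apply Rmult_le_compat_r; lra|].
      right; field; lra.
    + intros Eyz. assert (H : Cmod (gam s - gam sg) = 0%R).
      { rewrite <- Ey, <- Ez, Eyz, Cminus_diag. apply Cmod_0. }
      rewrite Hgam, Rabs_left1 in H by lra.
      apply Rmult_integral in H. lra.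
    + rewrite <- Efy. apply Hbelow; lra.
Qed.

Lemma analytic_order f (z0 : unit_disc) : analytic f -> (exists z, f z <> 0) ->
  exists k r B G, wiener r B G /\ G 0 <> 0 /\
    (forall z : unit_disc, (Cmod (z - z0) <= r)%R -> f z = ((z - z0) ^ k * G (z - z0))%C) /\
    forall z : unit_disc, (Cmod (z - z0) <= r)%R -> dval z <> z0 -> f z <> 0.
Proof.
  intros Hf [z Hz]. destruct (analytic_isolated_zeros f z0 Hf) as [[d [Hd H]]|H]; auto.
  exfalso; apply Hz. now apply (analytic_identity f z0 d).
Qed.

(** Near a point where [g] does not vanish, isolation of zeros gives a point where both factors are
    nonzero. This is the rule by which [psi] or [T psi] is cancelled from an identity, even at its
    zeros. *)
Lemma analytic_integral f g : analytic f -> analytic g ->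
  (forall z, (f z * g z)%C = 0) -> (exists z, f z <> 0) -> forall z, g z = 0.
Proof.
  intros Hf Hg H Hnz z. apply NNPP; intros Hgz.
  destruct (analytic_order f z Hf Hnz) as [k [r [B [F [HF [_ [_ H1]]]]]]].
  destruct (analytic_order g z Hg (ex_intro _ z Hgz)) as [k' [r' [B' [G [HG [_ [_ H2]]]]]]].
  assert (Hr : (0 < Rmin r r')%R) by (apply Rmin_glb_lt; [apply HF|apply HG]).
  destruct (near_point z _ Hr) as [y [Hne Hy]].
  pose proof (Rmin_l r r'); pose proof (Rmin_r r r').
  apply (Cmult_neq_0 (f y) (g y)); auto; [apply H1|apply H2]; auto; lra.
Qed.

Lemma analytic_eq_const f (z0 : unit_disc) (d : R) : analytic f -> (0 < d)%R ->
  (forall z : unit_disc, (Cmod (z - z0) < d)%R -> f z = f z0) -> forall z, f z = f z0.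
Proof.
  intros Hf Hd H z. replace (f z) with ((f z - f z0) + f z0)%C by ring.
  rewrite (analytic_identity (fun z => f z - f z0)%C z0 d); auto; [ring| |].
  - apply analytic_minus; auto using analytic_const.
  - intros y Hy. rewrite H by auto. ring.
Qed.

Lemma analytic_max_modulus f (z0 : unit_disc) : analytic f ->
  (forall z, (Cmod (f z) <= Cmod (f z0))%R) -> forall z, f z = f z0.
Proof.
  intros Hf Hmax. pose proof Hf as Hw. rewrite analytic_wiener in Hw.
  destruct (Hw z0) as [r [B [F [HF EF]]]].
  assert (Hr : (0 < r)%R) by apply HF. pose proof (disc_lt1 z0) as H0.
  set (d := (Rmin r ((1 - Cmod z0) / 2))%R).
  assert (Hd : (0 < d)%R) by (apply Rmin_glb_lt; lra).
  pose proof (Rmin_l r ((1 - Cmod z0) / 2)) as Hd1.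
  pose proof (Rmin_r r ((1 - Cmod z0) / 2)) as Hd2. fold d in Hd1, Hd2.
  assert (E0 : f z0 = F 0) by now apply (wiener_at_center f F r).
  apply analytic_eq_const with d; auto. intros z Hz. rewrite E0, EF by lra.
  apply (wiener_local_max d B F); [apply wiener_le with r B; auto; lra| |lra].
  intros t Ht. assert (h : (Cmod (z0 + t) < 1)%R) by (pose proof (Cmod_triangle z0 t); lra).
    specialize (Hmax (mk_unit_disc _ h)).
    assert (E1 : f (mk_unit_disc _ h) = F t)
      by (rewrite EF; simpl; replace (z0 + t - z0)%C with t by ring; [reflexivity|lra]).
    rewrite E0, E1 in Hmax; simpl in Hmax.
    exact Hmax.
Qed.

Lemma analytic_local_min f (z0 : unit_disc) (e : R) : analytic f -> (0 < e)%R -> f z0 <> 0 ->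
  (forall z : unit_disc, (Cmod (z - z0) <= e)%R -> (Cmod (f z0) <= Cmod (f z))%R) ->
  forall z, f z = f z0.
Proof.
  intros Hf He Hnz Hmin. pose proof Hf as Hw. rewrite analytic_wiener in Hw.
  destruct (Hw z0) as [r [B [F [HF EF]]]].
  assert (Hr : (0 < r)%R) by apply HF. pose proof (disc_lt1 z0) as H0.
  set (d := Rmin (Rmin r e) ((1 - Cmod z0) / 2)%R).
  assert (Hd : (0 < d)%R) by (repeat apply Rmin_glb_lt; lra).
  pose proof (Rmin_l (Rmin r e) ((1 - Cmod z0) / 2)) as Hd1.
  pose proof (Rmin_r (Rmin r e) ((1 - Cmod z0) / 2)) as Hd2.
  pose proof (Rmin_l r e) as Hd3. pose proof (Rmin_r r e) as Hd4. fold d in Hd1, Hd2.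
  assert (E0 : f z0 = F 0) by now apply (wiener_at_center f F r).
  destruct (wiener_local_min d B F) as [d' [Hd' HE]].
  - apply wiener_le with r B; auto; lra.
  - now rewrite <- E0.
  - intros t Ht. assert (h : (Cmod (z0 + t) < 1)%R) by (pose proof (Cmod_triangle z0 t); lra).
    specialize (Hmin (mk_unit_disc _ h)).
    assert (E1 : f (mk_unit_disc _ h) = F t)
      by (rewrite EF; simpl; replace (z0 + t - z0)%C with t by ring; [reflexivity|lra]).
    rewrite E0, E1 in Hmin; simpl in Hmin.
    apply Hmin. replace (z0 + t - z0)%C with t by ring; lra.
  - apply analytic_eq_const with d'; auto; [apply Hd'|]. intros z Hz.
    rewrite E0, EF by lra. apply HE; lra.
Qed.

(* Locally both functions are powers of [z - z0] times units of the Wiener algebra, and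
   the bound forces the order of [Q] to be at least that of [P]. *)
Lemma analytic_quotient_at P Q (z0 : unit_disc) (K d : R) :
  analytic P -> analytic Q -> (exists z, P z <> 0) -> (0 < d)%R ->
  (forall z : unit_disc, (Cmod (z - z0) < d)%R -> (Cmod (Q z) <= K * Cmod (P z))%R) ->
  exists r B H, wiener r B H /\
    forall z : unit_disc, (Cmod (z - z0) <= r)%R ->
      Q z = (P z * H (z - z0))%C /\ (dval z <> z0 -> P z <> 0).
Proof.
  intros HP HQ HPnz Hd Hb.
  destruct (analytic_order P z0 HP HPnz) as [k [r [B [p [Hp [Hp0 [EP HPn]]]]]]].
  destruct (wiener_inv _ _ _ Hp Hp0) as [s [B1 [Hs [Hip Hpn]]]].
  destruct (analytic_isolated_zeros Q z0 HQ) as [[e [He HQ0]]|[m [r2 [B2 [q [Hq [Hq0 [EQ _]]]]]]]].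
  { exists (Rmin s (e / 2)), (Cmod 0), (fun _ => RtoC 0); split.
    - apply wiener_const, Rmin_glb_lt; lra.
    - intros z Hz. pose proof (Rmin_l s (e / 2)); pose proof (Rmin_r s (e / 2)).
      split; [rewrite HQ0 by lra; ring|]. apply HPn; lra. }
  (* If [m < k], the bound gives [|q t| <= K' |t|] off 0, which fails for small [t] because
     [q 0 <> 0]. *)
  assert (Hkm : (k <= m)%nat).
  { apply Nat.nlt_ge; intros Hlt.
    destruct (wiener_away_0 _ _ _ Hq Hq0) as [r3 [Hr3 Haway]].
    apply Cmod_gt_0 in Hq0. pose proof (wiener_ge0 _ _ _ Hp) as HB.
    set (K' := (Rabs K * B + 1)%R).
    assert (HK : (0 < K')%R).
    { unfold K'. pose proof (Rabs_pos K). pose proof (Rmult_le_pos _ _ H HB). lra. }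
    (* [e] keeps all expansions and bounds valid, makes [|t| < 1], and by its last entry makes
       [K' |t| < |q 0| / 2]. *)
    set (e := Rmin (Rmin (Rmin r r3) (Rmin r2 d)) (Rmin 1 (Cmod (q 0) / 2 / K'))).
    assert (He : (0 < e)%R).
    { assert (0 < Cmod (q 0) / 2 / K')%R by (repeat apply Rdiv_lt_0_compat; lra).
      assert (0 < r2)%R by apply Hq.
      repeat apply Rmin_glb_lt; lra. }
    destruct (near_point z0 e He) as [z [Hne Hz]].
    unfold e in Hz; apply Rlt_gt in Hz.
    repeat match goal with H : (Rmin _ _ > _)%R |- _ =>
      apply Rmin_Rgt_l in H; destruct H as [? ?] end.
    set (t := (z - z0)%C) in *.
    specialize (Haway t ltac:(lra)).
    specialize (Hb z ltac:(fold t; lra)).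
    rewrite EP, EQ in Hb by (fold t; lra). fold t in Hb.
    rewrite !Cmod_mult, !Cmod_pow in Hb.
    replace k with (m + S (k - m - 1))%nat in Hb by lia.
    assert (Ht : (0 < Cmod t)%R) by (apply Cmod_gt_0, Csub_neq0; auto).
    assert (Htm : (0 < Cmod t ^ m)%R) by now apply pow_lt.
    rewrite pow_add, <- tech_pow_Rmult in Hb.
    assert (Hle : (Cmod t ^ (k - m - 1) <= 1)%R).
    { rewrite <- (pow1 (k - m - 1)). apply pow_incr; lra. }
    pose proof (wiener_bound _ _ _ t Hp ltac:(lra)) as Hpb.
    assert (Hq1 : (Cmod (q t) <= K' * Cmod t)%R).
    { apply Rmult_le_reg_l with (1 := Htm). eapply Rle_trans; [exact Hb|].
      set (x := (Cmod t ^ (k - m - 1))%R) in *.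
      assert (Hx : (0 <= x)%R) by (apply pow_le; lra).
      apply Rle_trans with (Rabs K * (Cmod t ^ m * (Cmod t * x) * Cmod (p t)))%R.
      { apply Rmult_le_compat_r; [|apply Rle_abs].
        repeat apply Rmult_le_pos; auto using Cmod_ge_0; lra. }
      replace (Rabs K * (Cmod t ^ m * (Cmod t * x) * Cmod (p t)))%R
        with (Cmod t ^ m * (Cmod t * (Rabs K * (x * Cmod (p t)))))%R by ring.
      apply Rmult_le_compat_l; [lra|]. rewrite (Rmult_comm K').
      apply Rmult_le_compat_l; [lra|]. unfold K'.
      apply Rle_trans with (Rabs K * B)%R; [|lra].
      apply Rmult_le_compat_l; [apply Rabs_pos|].
      rewrite <- (Rmult_1_l B). apply Rmult_le_compat; auto using Cmod_ge_0. }
    assert (Hlt' : (K' * Cmod t < K' * (Cmod (q 0) / 2 / K'))%R)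
      by (apply Rmult_lt_compat_l; lra).
    replace (K' * (Cmod (q 0) / 2 / K'))%R with (Cmod (q 0) / 2)%R in Hlt' by (field; lra).
    lra. }
  pose proof (Rmin_l s r2) as Hm1; pose proof (Rmin_r s r2) as Hm2.
  assert (Hm0 : (0 < Rmin s r2)%R) by (apply Rmin_glb_lt; [lra|apply Hq]).
  exists (Rmin s r2), (Rmin s r2 ^ (m - k) * (B2 * B1))%R,
    (fun t => t ^ (m - k) * (q t * / p t))%C; split.
  - apply wiener_pow_mult. apply wiener_mult.
    + apply wiener_le with r2 B2; [lra|apply Rle_refl|exact Hq].
    + apply wiener_le with s B1; [lra|apply Rle_refl|exact Hip].
  - intros z Hz. split; [|apply HPn; lra].
    rewrite EP, EQ by lra. specialize (Hpn (z - z0)%C ltac:(lra)).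
    replace m with (k + (m - k))%nat at 1 by lia. rewrite Cpow_add_r. field; auto.
Qed.

(** The local quotients are chosen independently, and the value at [z] is taken from the one centred
    at [z]. Near [z0] this agrees with the quotient centred at [z0], because there [P] vanishes at
    most at [z0]. *)
Lemma analytic_quotient P Q : analytic P -> analytic Q -> (exists z, P z <> 0) ->
  (forall z0 : unit_disc, exists K d, (0 < d)%R /\
    forall z : unit_disc, (Cmod (z - z0) < d)%R -> (Cmod (Q z) <= K * Cmod (P z))%R) ->
  exists h, analytic h /\ forall z, Q z = (P z * h z)%C.
Proof.
  intros HP HQ HPnz Hb.
  destruct (choice (fun (z0 : unit_disc) (H : C -> C) => exists r B, wiener r B H /\
    forall z : unit_disc, (Cmod (z - z0) <= r)%R ->
      Q z = (P z * H (z - z0))%C /\ (dval z <> z0 -> P z <> 0))) as [H HH].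
  { intros z0. destruct (Hb z0) as [K [d [Hd Hb0]]].
    destruct (analytic_quotient_at P Q z0 K d) as [r [B [H HH]]]; auto. exists H, r, B; auto. }
  assert (Hself : forall z, Q z = (P z * H z 0)%C).
  { intros z. destruct (HH z) as [r [B [HW HE]]].
    replace (RtoC 0) with (z - z)%C by ring. apply HE.
    rewrite Cminus_diag, Cmod_0. apply Rlt_le, HW. }
  exists (fun z => H z 0); split; auto.
  apply analytic_wiener; intros z0. destruct (HH z0) as [r [B [HW HE]]].
  exists r, B, (H z0); split; auto. intros z Hz.
  destruct (excluded_middle_informative (dval z = dval z0)) as [E|N].
  - rewrite E. apply dval_inj in E; subst z. f_equal; ring.
  - destruct (HE z Hz) as [E HPz]. specialize (HPz N). rewrite Hself in E.
    replace (H z 0) with (/ P z * (P z * H z 0))%C by (field; auto).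
    rewrite E. field; auto.
Qed.

Lemma analytic_inv f : analytic f -> (forall z, f z <> 0) -> analytic (fun z => / f z)%C.
Proof.
  intros Hf Hnz. pose proof (fun z => proj1 (Cmod_gt_0 _) (Hnz z)) as Hpos.
  destruct (analytic_quotient f (fun _ => 1) Hf (analytic_const 1)) as [h [Hh E]].
  - assert (H : (Cmod 0 < 1)%R) by (rewrite Cmod_0; lra).
    exists (mk_unit_disc _ H); auto.
  - intros z0. destruct (analytic_continuous f z0 (Cmod (f z0) / 2) Hf) as [d [Hd Hc]];
      [specialize (Hpos z0); lra|].
    exists (/ (Cmod (f z0) / 2))%R, d; split; auto. intros z Hz. specialize (Hc z Hz).
    specialize (Hpos z0). rewrite Cmod_minus_sym in Hc.
    pose proof (Cmod_minus_ge (f z0) (f z)). rewrite Cmod_1.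
    apply Rmult_le_reg_l with (Cmod (f z0) / 2)%R; [lra|].
    rewrite <- Rmult_assoc, Rinv_r; lra.
  - apply analytic_ext with (2 := Hh). intros z; specialize (Hnz z).
    transitivity (/ f z * (f z * h z))%C; [field; auto|rewrite <- E; ring].
Qed.

(** * The minimum principle *)

(** The uniform lower bound [d <= delta y] stands in for the choice of a finite subcover. *)
Lemma closed_disc_compact (c : C) (rho : R) (delta : C -> R) :
  (forall y, (Cmod (y - c) <= rho)%R -> (0 < delta y)%R) ->
  exists d, (0 < d)%R /\ forall x, (Cmod (x - c) <= rho)%R ->
    exists y, (Cmod (y - c) <= rho)%R /\ (Cmod (x - y) < delta y)%R /\ (d <= delta y)%R.
Proof.
  intros Hdelta.
  (* The gauge is extended to the plane so that compactness of a square applies. Coordinates closer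
     than the gauge give a distance below twice the gauge, hence the halves; for a centre outside,
     twice the gauge is its distance to the disc, so no point of the disc selects it. *)
  assert (Hpos : forall y : C, (0 < if Rle_dec (Cmod (y - c)) rho then delta y / 2
                                 else (Cmod (y - c) - rho) / 2)%R).
  { intros y. destruct (Rle_dec (Cmod (y - c)) rho) as [H|H]; [|lra].
    specialize (Hdelta y H); lra. }
  destruct (compactness_value_2d (fst c - rho) (fst c + rho) (snd c - rho) (snd c + rho)
    (fun u v => mkposreal _ (Hpos (u, v)))) as [d Hd].
  exists d; split; [apply cond_pos|]. intros [x1 x2] Hx.
  pose proof (Rle_trans _ _ _ (Rmax_Cmod _) Hx) as Hbox; simpl in Hbox.
  pose proof (Rle_trans _ _ _ (Rmax_l _ _) Hbox) as Hx1.
  pose proof (Rle_trans _ _ _ (Rmax_r _ _) Hbox) as Hx2.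
  apply Rabs_le_between in Hx1; apply Rabs_le_between in Hx2.
  destruct (NNPP _ (Hd x1 x2 ltac:(lra) ltac:(lra))) as [u [v [_ [_ [Hu [Hv Hduv]]]]]].
  simpl in Hu, Hv, Hduv.
  pose proof (Cmod_le_Re_Im ((x1, x2) - (u, v))) as Hxy; simpl in Hxy.
  destruct (Rle_dec (Cmod ((u, v) - c)) rho) as [H|H].
  - pose proof (cond_pos d). exists (u, v); repeat split; auto; unfold Rminus in *; lra.
  - exfalso.
    pose proof (Cmod_triangle ((x1, x2) - c) (- ((x1, x2) - (u, v)))) as Ht.
    rewrite Cmod_opp in Ht.
    replace ((x1, x2) - c + - ((x1, x2) - (u, v)))%C with ((u, v) - c)%C in Ht by ring.
    unfold Rminus in *. lra.
Qed.

(** Lower semicontinuity suffices: if the infimum were not attained, each point would have a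
    neighbourhood with a positive gap above it, and compactness would make the gap uniform. *)
Lemma closed_disc_min (c : C) (rho : R) (g : C -> R) :
  (0 <= rho)%R -> (forall y, (Cmod (y - c) <= rho)%R -> (0 <= g y)%R) ->
  (forall y e, (Cmod (y - c) <= rho)%R -> (0 < e)%R ->
     exists d, (0 < d)%R /\
       forall x, (Cmod (x - c) <= rho)%R -> (Cmod (x - y) < d)%R -> (g y - e < g x)%R) ->
  exists y0, (Cmod (y0 - c) <= rho)%R /\
    forall y, (Cmod (y - c) <= rho)%R -> (g y0 <= g y)%R.
Proof.
  intros Hrho Hg Hcont.
  assert (Hc : (Cmod (c - c) <= rho)%R)
    by (now rewrite Cminus_diag, Cmod_0).
  destruct (completeness (fun v => exists y, (Cmod (y - c) <= rho)%R /\ v = (- g y)%R))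
    as [m [Hub Hlub]].
  { exists 0%R; intros v [y [Hy ->]]. specialize (Hg y Hy); lra. }
  { exists (- g c)%R, c; auto. }
  assert (Hm : forall y, (Cmod (y - c) <= rho)%R -> (- m <= g y)%R).
  { intros y Hy. specialize (Hub (- g y)%R (ex_intro _ y (conj Hy eq_refl))). lra. }
  apply NNPP; intros Hn.
  assert (Hgt : forall y, (Cmod (y - c) <= rho)%R -> (- m < g y)%R).
  { intros y Hy. destruct (Rle_or_lt (g y) (- m)); auto. exfalso; apply Hn.
    exists y; split; auto. intros z Hz. specialize (Hm z Hz); lra. }
  destruct (choice (fun y d => (Cmod (y - c) <= rho)%R -> (0 < d)%R /\
     forall x, (Cmod (x - c) <= rho)%R -> (Cmod (x - y) < d)%R -> (- m + d < g x)%R))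
    as [delta Hdelta].
  { intros y. destruct (Rle_or_lt (Cmod (y - c)) rho) as [Hy|Hy]; [|exists 0%R; lra].
    specialize (Hgt y Hy).
    destruct (Hcont y ((g y + m) / 2)%R Hy) as [d [Hd Hx]]; [lra|].
    (* One number serves as radius and as gap: half of the excess [g y + m] over the infimum [- m]
       is given away. *)
    exists (Rmin d ((g y + m) / 2)); intros _.
    pose proof (Rmin_l d ((g y + m) / 2)); pose proof (Rmin_r d ((g y + m) / 2)).
    split; [apply Rmin_glb_lt; lra|]. intros x Hxr Hxy.
    specialize (Hx x Hxr ltac:(lra)). lra. }
  destruct (closed_disc_compact c rho delta) as [d [Hd Hfin]];
    [intros y Hy; now apply Hdelta|].
  assert (Hbad : (m <= m - d)%R); [|lra].
  apply Hlub. intros v [x [Hx ->]]. destruct (Hfin x Hx) as [y [Hy [Hxy Hdy]]].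
  pose proof (proj2 (Hdelta y Hy) x Hx Hxy). lra.
Qed.

(** The minimum over the closed disc is attained. At an interior point it makes [f] constant, and
    then the same value is taken on the circle, at [z0 + e]. *)
Lemma analytic_min_modulus f (z0 : C) (e eta : R) : analytic f -> (0 < e)%R ->
  (forall z : C, (Cmod (z - z0) <= e)%R -> (Cmod z < 1)%R) ->
  (forall z : unit_disc, (Cmod (z - z0) <= e)%R -> f z <> 0) ->
  (forall z : unit_disc, Cmod (z - z0) = e -> (eta <= Cmod (f z))%R) ->
  forall z : unit_disc, (Cmod (z - z0) <= e)%R -> (eta <= Cmod (f z))%R.
Proof.
  intros Hf He Hin Hnz Hcirc.
  destruct (closed_disc_min z0 e (fun z => Cmod (extend f z))) as [y0 [Hy0 Hmin]];
    [lra|intros; apply Cmod_ge_0| |].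
  { intros y d Hy Hd. pose proof (Hin y Hy) as h.
    destruct (analytic_continuous f (mk_unit_disc y h) d Hf Hd) as [r [Hr Hc]].
    exists r; split; auto. intros x Hx Hxy. pose proof (Hin x Hx) as h'.
    specialize (Hc (mk_unit_disc x h') Hxy).
    rewrite <- !(extend_dval f) in Hc; simpl in Hc.
    rewrite Cmod_minus_sym in Hc. pose proof (Cmod_minus_ge (extend f y) (extend f x)). lra. }
  pose proof (Hin y0 Hy0) as h0. set (z1 := mk_unit_disc y0 h0).
  assert (E1 : extend f y0 = f z1) by (now rewrite <- extend_dval).
  rewrite E1 in Hmin.
  assert (Hmin' : forall z : unit_disc, (Cmod (z - z0) <= e)%R -> (Cmod (f z1) <= Cmod (f z))%R)
    by (intros z Hz; rewrite <- (extend_dval f z); auto).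
  enough (H : (eta <= Cmod (f z1))%R)
    by (intros z Hz; eapply Rle_trans; [exact H|]; auto).
  destruct (Rle_or_lt e (Cmod (y0 - z0))) as [Hge|Hlt]; [apply Hcirc; simpl; lra|].
  assert (Hconst : forall z, f z = f z1).
  { apply analytic_local_min with (e - Cmod (y0 - z0))%R; [auto|lra|now apply Hnz|].
    intros z Hz; apply Hmin'. simpl in Hz.
    pose proof (Cmod_triangle (z - y0) (y0 - z0)) as Ht.
    replace (z - y0 + (y0 - z0))%C with (z - z0)%C in Ht by ring. lra. }
  assert (Ee : Cmod (z0 + e - z0) = e)
    by (replace (z0 + e - z0)%C with (RtoC e) by ring; rewrite Cmod_R, Rabs_pos_eq; lra).
  assert (h : (Cmod (z0 + e) < 1)%R) by (apply Hin; lra).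
  rewrite <- (Hconst (mk_unit_disc _ h)). now apply Hcirc.
Qed.

(** * Bijective analytic self-maps of the disc *)

(* If [phi z] were close to [w = phi z*] for some [z] away from [z*], then [phi - phi z]
   would have no zero in a small disc about [z*], be large on its boundary and small at
   its centre, contradicting the minimum principle. *)
Lemma aut_away_from_value phi (w : unit_disc) : Aut_disc phi ->
  exists d, (0 < d)%R /\
    forall z : unit_disc, (1 - d <= Cmod z)%R -> (d <= Cmod (phi z - w))%R.
Proof.
  intros [Hphi [psi Hpsi1 Hpsi2]]. set (z0 := psi w).
  assert (Hw : phi z0 = w) by apply Hpsi2. pose proof (disc_lt1 z0) as H0.
  assert (Hinj : forall x y, dval (phi x) = phi y -> x = y).
  { intros x y E. apply dval_inj in E. rewrite <- (Hpsi1 x), <- (Hpsi1 y). now f_equal. }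
  set (f := fun z => (phi z - w)%C).
  assert (Hf : analytic f) by (apply analytic_minus; auto using analytic_const).
  destruct (analytic_order f z0 Hf) as [k [r [B [G [HG [HG0 [EG _]]]]]]].
  { destruct (near_point z0 1 Rlt_0_1) as [y [Hy _]]. exists y. apply Csub_neq0.
    rewrite <- Hw. intros E; apply Hinj in E; congruence. }
  destruct (wiener_away_0 _ _ _ HG HG0) as [r' [Hr' Haway]]. apply Cmod_gt_0 in HG0.
  set (e := Rmin r' ((1 - Cmod z0) / 2)).
  assert (He : (0 < e)%R) by (apply Rmin_glb_lt; lra).
  pose proof (Rmin_l r' ((1 - Cmod z0) / 2)) as He1.
  pose proof (Rmin_r r' ((1 - Cmod z0) / 2)) as He2. fold e in He1, He2.
  (* A lower bound for [|phi - w| = e^k |G|] on the circle of radius [e] about [z0]. *)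
  set (eta := (e ^ k * (Cmod (G 0) / 2))%R).
  assert (Heta : (0 < eta)%R) by (apply Rmult_lt_0_compat; [now apply pow_lt|lra]).
  (* The second entry keeps points with [|z| >= 1 - d] out of the disc of radius [e]; the first
     leaves [|phi - phi z| >= eta / 2] on the circle, against a value below [d] at the centre. *)
  set (d := Rmin (eta / 2) ((1 - Cmod z0) / 4)).
  pose proof (Rmin_l (eta / 2) ((1 - Cmod z0) / 4)) as Hd1.
  pose proof (Rmin_r (eta / 2) ((1 - Cmod z0) / 4)) as Hd2. fold d in Hd1, Hd2.
  exists d; split; [apply Rmin_glb_lt; lra|]. intros z Hz.
  destruct (Rle_or_lt d (Cmod (phi z - w))) as [|Hlt]; auto. exfalso.
  assert (Hmin : (eta / 2 <= Cmod (phi z0 - phi z))%R).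
  { apply (analytic_min_modulus (fun y => phi y - phi z)%C z0 e).
    - apply analytic_minus; auto using analytic_const.
    - exact He.
    - intros y Hy. pose proof (Cmod_triangle (y - z0) z0) as Ht.
      replace (y - z0 + z0)%C with y in Ht by ring. lra.
    - intros y Hy. apply Csub_neq0. intros E; apply Hinj in E; subst y.
      pose proof (Cmod_triangle (z - z0) z0) as Ht.
      replace (z - z0 + z0)%C with (dval z) in Ht by ring. lra.
    - intros y Hy. pose proof (Cmod_minus_ge (f y) (phi z - w)) as Ht.
      replace (f y - (phi z - w))%C with (phi y - phi z)%C in Ht by (unfold f; ring).
      assert (Hfy : (eta <= Cmod (f y))%R); [|lra].
      rewrite EG by lra. rewrite Cmod_mult, Cmod_pow, Hy. unfold eta.
      apply Rmult_le_compat_l; [apply pow_le; lra|]. apply Haway; lra.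
    - rewrite Cminus_diag, Cmod_0; lra. }
  rewrite Hw, Cmod_minus_sym in Hmin. lra.
Qed.

(** Each value [w] is avoided near the boundary with a margin depending on [w]; compactness of the
    disc [|w| <= rho] makes the margin uniform. *)
Lemma aut_proper phi (rho : R) : Aut_disc phi -> (rho < 1)%R ->
  exists d, (0 < d)%R /\ forall z : unit_disc, (1 - d <= Cmod z)%R -> (rho < Cmod (phi z))%R.
Proof.
  intros Hphi Hrho.
  destruct (choice _ (fun w => aut_away_from_value phi w Hphi)) as [delta Hdelta].
  destruct (closed_disc_compact 0 rho (fun y => match Rlt_dec (Cmod y) 1 with
    | left h => delta (mk_unit_disc y h) | right _ => 1%R end)) as [d [Hd Hfin]].
  { intros y Hy. destruct (Rlt_dec (Cmod y) 1); [apply Hdelta|lra]. }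
  exists d; split; auto. intros z Hz.
  destruct (Rle_or_lt (Cmod (phi z)) rho) as [Hle|]; auto. exfalso.
  destruct (Hfin (phi z)) as [y [Hy [Hxy Hdy]]];
    [replace (phi z - 0)%C with (dval (phi z)) by ring; auto|].
  replace (y - 0)%C with y in Hy by ring.
  destruct (Rlt_dec (Cmod y) 1) as [h|h]; [|lra].
  destruct (Hdelta (mk_unit_disc y h)) as [_ Haway]. specialize (Haway z ltac:(lra)).
  simpl in Haway. lra.
Qed.

(** * Estimates for the Moebius maps of the disc *)

Lemma mobius_identity (a z : C) :
  (Cmod (1 - Cconj a * z) ^ 2 - Cmod (z - a) ^ 2 = (1 - Cmod a ^ 2) * (1 - Cmod z ^ 2))%R.
Proof.
  rewrite !Cmod2_alt. destruct a as [a1 a2], z as [z1 z2]. simpl. ring.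
Qed.

Lemma mobius_denominator (a z : C) : (Cmod a < 1)%R -> (Cmod z < 1)%R ->
  (1 - Cmod a <= Cmod (1 - Cconj a * z))%R.
Proof.
  intros Ha Hz. pose proof (Cmod_minus_ge 1 (Cconj a * z)) as H.
  rewrite Cmod_1, Cmod_mult, Cmod_conj in H.
  pose proof (Cmod_ge_0 a). pose proof (Cmod_ge_0 z). nra.
Qed.

Lemma mobius_le (a z : C) : (Cmod a < 1)%R -> (Cmod z < 1)%R ->
  (Cmod (z - a) <= Cmod (1 - Cconj a * z))%R.
Proof.
  intros Ha Hz. pose proof (mobius_identity a z) as H.
  pose proof (Cmod_ge_0 a). pose proof (Cmod_ge_0 z).
  pose proof (Cmod_ge_0 (z - a)). pose proof (Cmod_ge_0 (1 - Cconj a * z)).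
  apply Rsqr_incr_0; auto. unfold Rsqr.
  assert (0 <= (1 - Cmod a ^ 2) * (1 - Cmod z ^ 2))%R by (apply Rmult_le_pos; nra). nra.
Qed.

(** With [D], [N] the two moduli, [q = 1 - |a|] and [x = 2 d / q^2], the identity gives
    [D^2 - N^2 <= 2 d <= x D^2], since [D >= q]. Then [N D >= N^2 >= (1 - x) D^2], and dividing by
    [D] avoids square roots. *)
Lemma mobius_boundary (a z : C) (d : R) : (Cmod a < 1)%R -> (Cmod z < 1)%R ->
  (1 - d <= Cmod z)%R ->
  ((1 - 2 * d / (1 - Cmod a) ^ 2) * Cmod (1 - Cconj a * z) <= Cmod (z - a))%R.
Proof.
  intros Ha Hz Hd. pose proof (mobius_identity a z) as H.
  pose proof (mobius_denominator a z Ha Hz) as HD. pose proof (mobius_le a z Ha Hz) as HL.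
  pose proof (Cmod_ge_0 a). pose proof (Cmod_ge_0 z). pose proof (Cmod_ge_0 (z - a)).
  set (D := Cmod (1 - Cconj a * z)) in *. set (N := Cmod (z - a)) in *.
  set (q := (1 - Cmod a)%R) in *.
  assert (Hq0 : (0 < q)%R) by (unfold q; lra).
  assert (Hq : (0 < q ^ 2)%R) by now apply pow_lt.
  assert (HD2 : (q ^ 2 <= D ^ 2)%R) by (apply pow_incr; lra).
  assert (Hgap : (D ^ 2 - N ^ 2 <= 2 * d)%R).
  { rewrite H. apply Rle_trans with (1 * (2 * d))%R; [|lra].
    apply Rmult_le_compat; nra. }
  clearbody q. set (x := (2 * d / q ^ 2)%R).
  assert (Hx : (2 * d = x * q ^ 2)%R) by (unfold x; field; lra).
  assert (HD0 : (0 < D)%R) by lra.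
  assert (Hx0 : (0 <= x)%R) by (apply Rlt_le, Rdiv_lt_0_compat; lra).
  pose proof (Rmult_le_compat_l x _ _ Hx0 HD2) as H3.
  pose proof (Rmult_le_compat_l N _ _ H2 HL) as H4.
  apply Rmult_le_reg_r with (1 := HD0). nra.
Qed.

Lemma bernoulli_minus (x : R) (k : nat) : (0 <= x <= 1)%R -> (1 - INR k * x <= (1 - x) ^ k)%R.
Proof.
  intros Hx; induction k as [|k IH]; [simpl; lra|]. rewrite S_INR; simpl.
  pose proof (pos_INR k).
  apply Rle_trans with ((1 - x) * (1 - INR k * x))%R; [|apply Rmult_le_compat_l; lra].
  assert (0 <= INR k * (x * x))%R by (apply Rmult_le_pos; nra). nra.
Qed.

Lemma Cmod_0_lt_1 : (Cmod 0 < 1)%R.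
Proof. rewrite Cmod_0; lra. Qed.

Definition disc0 : unit_disc := mk_unit_disc 0 Cmod_0_lt_1.

Lemma mobius_denominator_neq0 (a z : C) : (Cmod a < 1)%R -> (Cmod z < 1)%R ->
  (1 - Cconj a * z)%C <> 0.
Proof.
  intros Ha Hz. apply Cmod_gt_0. pose proof (mobius_denominator a z Ha Hz). lra.
Qed.

(** The bound required of the quotient comes from the expansion of [f] near [a]; elsewhere [f] is
    bounded and [(z - a)^k] stays locally away from 0. *)
Lemma analytic_factor_zero f (a : unit_disc) : analytic f -> bounded_fun f ->
  (exists z, f z <> 0) ->
  exists k h, analytic h /\ h a <> 0 /\ forall z : unit_disc, f z = ((z - a) ^ k * h z)%C.
Proof.
  intros Hf [M HM] Hnz.
  destruct (analytic_order f a Hf Hnz) as [k [r [B [G [HG [HG0 [EG _]]]]]]].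
  assert (Hr : (0 < r)%R) by apply HG.
  assert (HP : analytic (fun z : unit_disc => (z - a) ^ k)%C)
    by (apply analytic_pow, analytic_minus; [apply analytic_id|apply analytic_const]).
  destruct (analytic_quotient _ f HP Hf) as [h [Hh E]].
  { destruct (near_point a 1 Rlt_0_1) as [z [Hz _]]. exists z. now apply Cpow_nz, Csub_neq0. }
  { intros z0. destruct (excluded_middle_informative (dval z0 = a)) as [E|N].
    - exists B, r; split; auto. rewrite E; intros z Hz. rewrite EG, Cmod_mult, Rmult_comm by lra.
      apply Rmult_le_compat_r; [apply Cmod_ge_0|]. apply (wiener_bound _ _ _ _ HG); lra.
    - assert (Hc : (0 < Cmod ((z0 - a) ^ k))%R) by (apply Cmod_gt_0, Cpow_nz, Csub_neq0; auto).
      destruct (analytic_continuous _ z0 (Cmod ((z0 - a) ^ k) / 2) HP) as [d [Hd H]]; [lra|].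
      exists (M * / (Cmod ((z0 - a) ^ k) / 2))%R, d; split; auto.
      intros z Hz. specialize (H z Hz). specialize (HM z).
      rewrite Cmod_minus_sym in H.
      pose proof (Cmod_minus_ge ((z0 - a) ^ k) ((z - a) ^ k)).
      set (x := Cmod ((z0 - a) ^ k)) in *. pose proof (Cmod_ge_0 (f z)).
      apply Rle_trans with (M * / (x / 2) * (x / 2))%R.
      + rewrite Rmult_assoc, Rinv_l; lra.
      + apply Rmult_le_compat_l; [|lra]. apply Rmult_le_pos; [lra|].
        apply Rlt_le, Rinv_0_lt_compat; lra. }
  (* [h] is known only as a quotient, so [h a <> 0] comes by continuity from points near [a] and
     distinct from it, where [h] agrees with [G]. *)
  exists k, h; split; auto; split; auto. intros Ha.
  destruct (wiener_away_0 _ _ _ HG HG0) as [d [Hd Haway]]. apply Cmod_gt_0 in HG0.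
  destruct (analytic_continuous h a (Cmod (G 0) / 2) Hh) as [e [He Hc]]; [lra|].
  destruct (near_point a (Rmin d e)) as [z [Hne Hz]]; [apply Rmin_glb_lt; lra|].
  pose proof (Rmin_l d e); pose proof (Rmin_r d e).
  specialize (Hc z ltac:(lra)). specialize (Haway (z - a)%C ltac:(lra)).
  assert (Ez : h z = G (z - a)%C).
  { specialize (E z). rewrite EG in E by lra.
    assert (Hp : ((z - a) ^ k)%C <> 0) by now apply Cpow_nz, Csub_neq0.
    transitivity (/ (z - a) ^ k * ((z - a) ^ k * h z))%C; [field; auto|].
    rewrite <- E. field; auto. }
  rewrite Ha, Ez in Hc. replace (G (z - a) - 0)%C with (G (z - a)%C) in Hc by ring. lra.
Qed.

(* A nonvanishing function whose modulus tends to 1 at the boundary is constant: by the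
   minimum principle for [u] and [1/u], [|u| = 1] everywhere. *)
Lemma unimodular_boundary_const u : analytic u -> (forall z, u z <> 0) ->
  (forall rho, (rho < 1)%R -> exists d, (0 < d)%R /\ forall z : unit_disc,
     (1 - d <= Cmod z)%R -> (rho <= Cmod (u z))%R /\ (rho <= / Cmod (u z))%R) ->
  exists c, Cmod c = 1%R /\ forall z, u z = c.
Proof.
  intros Hu Hnz Hb.
  assert (Hmin : forall rho v, (rho < 1)%R -> analytic v -> (forall z, v z <> 0) ->
    (exists d, (0 < d)%R /\
      forall z : unit_disc, (1 - d <= Cmod z)%R -> (rho <= Cmod (v z))%R) ->
    forall z, (rho <= Cmod (v z))%R).
  { intros rho v Hrho Hv Hvnz [d [Hd H]] z. pose proof (disc_lt1 z) as Hz.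
    (* A circle about 0 that encloses [z] and lies in the boundary region; 1/2 makes its radius
       positive. *)
    set (r := Rmax (Rmax (Cmod z) (1 - d)) (1 / 2)).
    assert (Hr : (r < 1)%R) by (repeat apply Rmax_lub_lt; lra).
    pose proof (Rmax_l (Rmax (Cmod z) (1 - d)) (1 / 2)) as H1.
    pose proof (Rmax_r (Rmax (Cmod z) (1 - d)) (1 / 2)) as H2.
    pose proof (Rmax_l (Cmod z) (1 - d)) as H3.
    pose proof (Rmax_r (Cmod z) (1 - d)) as H4. fold r in H1, H2.
    assert (E0 : forall x : C, (x - 0)%C = x) by (intros; ring).
    apply (analytic_min_modulus v 0 r); auto; try lra.
    - intros x; rewrite E0; lra.
    - intros x; rewrite E0; intros; apply H; lra.
    - rewrite E0; lra. }
  assert (H1 : forall z, Cmod (u z) = 1%R).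
  { intros z. pose proof (proj1 (Cmod_gt_0 _) (Hnz z)) as Hpos.
    (* If [|u z| > 1], the midpoint of 1 and [1 / |u z|] is a boundary bound for [1 / u] that fails
       at [z]; if [|u z| < 1], the midpoint of 1 and [|u z|] is one for [u]. *)
    apply Rle_antisym; apply Rnot_lt_le; intros Hlt.
    - assert (Hinv : (/ Cmod (u z) < 1)%R)
        by (rewrite <- Rinv_1; apply Rinv_lt_contravar; lra).
      assert (H : ((1 + / Cmod (u z)) / 2 <= Cmod (/ u z))%R); [|rewrite Cmod_inv in H; auto; lra].
      apply (Hmin _ (fun z => / u z)%C); [lra|now apply analytic_inv| |].
      + intros y Hy. apply C1_nz. rewrite <- (Cinv_r (u y)), Hy by auto. ring.
      + destruct (Hb ((1 + / Cmod (u z)) / 2)%R) as [d [Hd H]]; [lra|].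
        exists d; split; auto. intros y Hy. rewrite Cmod_inv by auto. now apply H.
    - assert (H : ((1 + Cmod (u z)) / 2 <= Cmod (u z))%R); [|lra].
      apply (Hmin _ u); [lra|auto|auto|].
      destruct (Hb ((1 + Cmod (u z)) / 2)%R) as [d [Hd H]]; [lra|].
      exists d; split; auto. intros y Hy; now apply H. }
  exists (u disc0); split; auto. apply analytic_max_modulus; auto.
  intros z; rewrite !H1; lra.
Qed.

Lemma Aut_disc_formula phi : Aut_disc phi ->
  exists (a : unit_disc) (c : C), Cmod c = 1%R /\
    forall z : unit_disc, (phi z * (1 - Cconj a * z))%C = (c * (z - a))%C.
Proof.
  intros Haut. pose proof Haut as [Hphi [psi Hpsi1 Hpsi2]].
  assert (Hinj : forall x y, dval (phi x) = phi y -> x = y).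
  { intros x y E. apply dval_inj in E. rewrite <- (Hpsi1 x), <- (Hpsi1 y). now f_equal. }
  set (a := psi disc0). assert (Ha : dval (phi a) = 0) by (unfold a; now rewrite Hpsi2).
  pose proof (disc_lt1 a) as Ha1.
  destruct (analytic_factor_zero (fun z => phi z) a Hphi) as [k [h [Hh [Hha E]]]].
  { exists 1%R; intros z; apply Rlt_le, disc_lt1. }
  { destruct (near_point a 1 Rlt_0_1) as [y [Hy _]]. exists y. rewrite <- Ha.
    intros E; apply Hinj in E; congruence. }
  assert (Hden : forall z : unit_disc, (1 - Cconj a * z)%C <> 0)
    by (intros z; apply mobius_denominator_neq0; apply disc_lt1).
  (* [u] is [phi] divided by the [k]-th power of the Moebius factor [(z - a) / (1 - conj a z)],
     written so that it makes sense at [a]. *)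
  set (u := fun z : unit_disc => ((1 - Cconj a * z) ^ k * h z)%C).
  assert (Eu : forall z : unit_disc,
    (phi z * (1 - Cconj a * z) ^ k)%C = ((z - a) ^ k * u z)%C)
    by (intros z; unfold u; rewrite E; ring).
  assert (Hh0 : forall z, h z <> 0).
  { intros z Hz. destruct (excluded_middle_informative (z = a)) as [->|N]; auto.
    apply N, Hinj. rewrite Ha, E, Hz; ring. }
  assert (Hu : analytic u).
  { apply analytic_mult; auto. apply analytic_pow, analytic_minus; [apply (analytic_const 1)|].
    apply analytic_mult; [apply analytic_const|apply analytic_id]. }
  assert (Hu0 : forall z, u z <> 0)
    by (intros z; apply Cmult_neq_0; auto; now apply Cpow_nz).
  destruct (unimodular_boundary_const u Hu Hu0) as [c [Hc Euc]].
  { intros rho Hrho.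
    destruct (aut_proper phi rho Haut Hrho) as [d1 [Hd1 Hprop]].
    set (q := ((1 - Cmod a) ^ 2)%R).
    assert (Hq : (0 < q <= 1)%R).
    { unfold q. pose proof (Cmod_ge_0 a). split; [apply pow_lt; lra|].
      rewrite <- (pow1 2). apply pow_incr; lra. }
    pose proof (pos_INR k) as Hk.
    (* [x0] is so small that Bernoulli's inequality gives [(1 - x0)^k >= 1 - k x0 >= rho]; the
       boundary distance [x0 q / 2] below is the one for which [mobius_boundary] yields the factor
       [1 - x0]. *)
    set (x0 := Rmin 1 ((1 - rho) / (INR k + 1))).
    assert (Hx0 : (0 < x0)%R)
      by (apply Rmin_glb_lt; [lra|]; apply Rdiv_lt_0_compat; lra).
    pose proof (Rmin_l 1 ((1 - rho) / (INR k + 1))) as Hx1.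
    pose proof (Rmin_r 1 ((1 - rho) / (INR k + 1))) as Hx2. fold x0 in Hx1, Hx2.
    assert (Hkx : (INR k * x0 <= 1 - rho)%R).
    { apply Rle_trans with (INR k * ((1 - rho) / (INR k + 1)))%R;
        [now apply Rmult_le_compat_l|].
      apply Rmult_le_reg_r with (INR k + 1)%R; [lra|].
      replace (INR k * ((1 - rho) / (INR k + 1)) * (INR k + 1))%R
        with (INR k * (1 - rho))%R by (field; lra). nra. }
    assert (Hd2 : (0 < x0 * q / 2)%R) by (apply Rdiv_lt_0_compat; [apply Rmult_lt_0_compat|]; lra).
    exists (Rmin d1 (x0 * q / 2)); split; [apply Rmin_glb_lt; lra|].
    pose proof (Rmin_l d1 (x0 * q / 2)); pose proof (Rmin_r d1 (x0 * q / 2)).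
    intros z Hz. pose proof (disc_lt1 z) as Hz1.
    specialize (Hprop z ltac:(lra)).
    pose proof (mobius_boundary a z (x0 * q / 2) Ha1 Hz1 ltac:(lra)) as Hbd.
    fold q in Hbd. replace (2 * (x0 * q / 2) / q)%R with x0 in Hbd by (field; lra).
    pose proof (mobius_le a z Ha1 Hz1) as Hle.
    specialize (Eu z). apply (f_equal Cmod) in Eu. rewrite !Cmod_mult, !Cmod_pow in Eu.
    pose proof (proj1 (Cmod_gt_0 _) (Hden z)) as HD.
    pose proof (proj1 (Cmod_gt_0 _) (Hu0 z)) as HU.
    pose proof (disc_lt1 (phi z)) as Hphi1. pose proof (Cmod_ge_0 (phi z)) as Hphi0.
    set (D := Cmod (1 - Cconj a * z)) in *. set (N := Cmod (z - a)) in *.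
    set (U := Cmod (u z)) in *.
    assert (HN : (0 <= N)%R) by apply Cmod_ge_0.
    assert (HDk : (0 < D ^ k)%R) by now apply pow_lt.
    assert (HNk : (N ^ k <= D ^ k)%R) by (apply pow_incr; lra).
    assert (HNk0 : (0 <= N ^ k)%R) by now apply pow_le.
    (* [|u| >= |phi|] because the Moebius factor has modulus at most 1, and [1 / |u| >= (1 - x0)^k]
       because [|phi| < 1]. *)
    split.
    - apply Rle_trans with (Cmod (phi z)); [lra|].
      apply Rmult_le_reg_r with (1 := HDk). rewrite Eu, Rmult_comm.
      apply Rmult_le_compat_l; lra.
    - apply Rle_trans with ((1 - x0) ^ k)%R.
      { pose proof (bernoulli_minus x0 k ltac:(lra)). lra. }
      apply Rmult_le_reg_r with (1 := HU). rewrite Rinv_l by lra.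
      apply Rmult_le_reg_r with (1 := HDk). rewrite Rmult_1_l.
      apply Rle_trans with (Cmod (phi z) * D ^ k)%R; [|nra].
      rewrite Eu.
      replace ((1 - x0) ^ k * U * D ^ k)%R with (((1 - x0) * D) ^ k * U)%R
        by (rewrite Rpow_mult_distr; ring).
      apply Rmult_le_compat_r; [lra|]. apply pow_incr; split; auto.
      apply Rmult_le_pos; lra. }
  exists a, c; split; auto.
  destruct k as [|[|k]].
  - exfalso. specialize (E a). rewrite Ha in E. apply (Hh0 a).
    change ((a - a) ^ 0)%C with (RtoC 1) in E.
    replace (h a) with (1 * h a)%C by ring. now rewrite <- E.
  - intros z. specialize (Eu z). rewrite Euc in Eu. rewrite !Cpow_1_r in Eu.
    rewrite Eu; ring.
  (* For an exponent of at least 2, the points where the Moebius factor equals [1 / 2] and [e / 2],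
     with [e] a nontrivial root of unity, would have the same image. *)
  - exfalso.
    destruct (nontrivial_root_of_unity (S (S k))) as [e [He1 [He2 He3]]]; [lia|].
    assert (Hpt : forall t : C, (Cmod t < 1)%R ->
      exists z : unit_disc, (z - a)%C = (t * (1 - Cconj a * z))%C).
    { intros t Ht.
      (* The inverse Moebius map is [(t + a) / (1 + conj a t)], written with [- a] so that the
         estimates above apply. *)
      assert (Hn : (1 - Cconj (- a) * t)%C <> 0)
        by (apply mobius_denominator_neq0; rewrite ?Cmod_opp; auto).
      assert (h1 : (Cmod ((t + a) / (1 - Cconj (- a) * t)) < 1)%R).
      { rewrite Cmod_div by auto. apply Cmod_gt_0 in Hn.
        apply Rmult_lt_reg_r with (1 := Hn). unfold Rdiv.
        rewrite Rmult_assoc, Rinv_l, Rmult_1_l, Rmult_1_r by lra.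
        pose proof (mobius_identity (- a) t) as HI.
        replace (t - - a)%C with (t + a)%C in HI by ring. rewrite Cmod_opp in HI.
        pose proof (Cmod_ge_0 a). pose proof (Cmod_ge_0 t).
        assert (0 < (1 - Cmod a ^ 2) * (1 - Cmod t ^ 2))%R by (apply Rmult_lt_0_compat; nra).
        apply Rsqr_incrst_0; [unfold Rsqr; nra|apply Cmod_ge_0|lra]. }
      exists (mk_unit_disc _ h1); simpl. rewrite Copp_conj in *. field.
      intros E0; apply Hn. rewrite <- E0; ring. }
    assert (Hm : forall b : C, Cmod b = 1%R -> (Cmod (b / 2) < 1)%R).
    { intros b Hb. rewrite Cmod_div, Hb, Cmod_R, Rabs_pos_eq; try lra.
      intros E0; apply (f_equal fst) in E0; simpl in E0; lra. }
    destruct (Hpt (1 / 2)%C) as [z1 Hz1]; [apply Hm, Cmod_1|].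
    destruct (Hpt (e / 2)%C) as [z2 Hz2]; [now apply Hm|].
    assert (H2 : RtoC 2 <> 0) by (intros E0; apply (f_equal fst) in E0; simpl in E0; lra).
    assert (Hval : forall (z : unit_disc) (t : C), (z - a)%C = (t * (1 - Cconj a * z))%C ->
      dval (phi z) = (t ^ S (S k) * c)%C).
    { intros z t Ht. pose proof (Eu z) as E1. rewrite Euc, Ht, Cpow_mult_l in E1.
      pose proof (Cpow_nz _ (S (S k)) (Hden z)) as Hn.
      transitivity (phi z * (1 - Cconj a * z) ^ S (S k) * / (1 - Cconj a * z) ^ S (S k))%C;
        [field; auto|]. rewrite E1. field; auto. }
    assert (E12 : z1 = z2).
    { apply Hinj. rewrite (Hval z1 _ Hz1), (Hval z2 _ Hz2).
      unfold Cdiv. rewrite !Cpow_mult_l, He2, Cpow_1_l. ring. }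
    subst z2. apply He3. rewrite Hz2 in Hz1.
    pose proof (Hden z1) as Hn.
    transitivity (e / 2 * (1 - Cconj a * z1) * (2 * / (1 - Cconj a * z1)))%C; [field; auto|].
    rewrite Hz1. field; auto.
Qed.

Lemma Aut_disc_inv phi psi : Aut_disc phi -> cancel psi phi -> analytic (fun w => dval (psi w)).
Proof.
  intros Hphi Hpsi. destruct (Aut_disc_formula phi Hphi) as [a [c [Hc E]]].
  assert (Hn : forall w : unit_disc, (c + Cconj a * w)%C <> 0).
  { intros w. apply Cmod_gt_0. pose proof (Cmod_minus_ge c (- (Cconj a * w))) as H.
    replace (c - - (Cconj a * w))%C with (c + Cconj a * w)%C in H by ring.
    rewrite Cmod_opp, Cmod_mult, Cmod_conj, Hc in H.
    pose proof (disc_lt1 a); pose proof (disc_lt1 w).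
    pose proof (Cmod_ge_0 a); pose proof (Cmod_ge_0 w). nra. }
  (* The Moebius relation is linear in [z] and is solved for it; the denominator is nonzero because
     [|c| = 1] and [|a w| < 1]. *)
  apply analytic_ext with (fun w => (w + a * c) * / (c + Cconj a * w))%C.
  - intros w. specialize (E (psi w)). rewrite Hpsi in E. specialize (Hn w).
    replace (w + a * c)%C with (psi w * (c + Cconj a * w))%C; [field; auto|].
    replace (psi w * (c + Cconj a * w))%C with
      (c * (psi w - a) + Cconj a * psi w * w + a * c)%C by ring.
    rewrite <- E. ring.
  - apply analytic_mult.
    + apply analytic_plus; [apply analytic_id|apply analytic_const].
    + apply analytic_inv; auto. apply analytic_plus; [apply analytic_const|].
      apply analytic_mult; [apply analytic_const|apply analytic_id].
Qed.

(** * Automorphisms of the algebra psi H^oo *)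

Lemma Hinfty_const c : Hinfty (fun _ => c).
Proof. split; [apply analytic_const|]. exists (Cmod c); intros; lra. Qed.

Lemma Hinfty_id : Hinfty (fun z => dval z).
Proof. split; [apply analytic_id|]. exists 1%R; intros z; apply Rlt_le, disc_lt1. Qed.

Lemma Hinfty_add f g : Hinfty f -> Hinfty g -> Hinfty (fadd f g).
Proof.
  intros [Hf [M HM]] [Hg [N HN]]; split; [now apply analytic_plus|].
  exists (M + N)%R; intros z. eapply Rle_trans; [apply Cmod_triangle|].
  now apply Rplus_le_compat.
Qed.

Lemma Hinfty_mul f g : Hinfty f -> Hinfty g -> Hinfty (fmul f g).
Proof.
  intros [Hf [M HM]] [Hg [N HN]]; split; [now apply analytic_mult|].
  exists (M * N)%R; intros z. unfold fmul; rewrite Cmod_mult.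
  apply Rmult_le_compat; auto using Cmod_ge_0.
Qed.

Lemma Hinfty_comp f phi : Hinfty f -> analytic (fun z => dval (phi z)) -> Hinfty (comp_op phi f).
Proof.
  intros [Hf [M HM]] Hphi; split; [exact (analytic_comp f phi Hf Hphi)|].
  exists M; intros z; apply HM.
Qed.

(** The bound on [h] is immediate where [P] does not vanish and reaches its isolated zeros by
    continuity. *)
Lemma analytic_bounded_quotient P Q (K : R) :
  analytic P -> analytic Q -> (exists z, P z <> 0) ->
  (forall z, (Cmod (Q z) <= K * Cmod (P z))%R) ->
  exists h, analytic h /\ (forall z, (Cmod (h z) <= K)%R) /\ forall z, Q z = (P z * h z)%C.
Proof.
  intros HP HQ Hnz HK.
  destruct (analytic_quotient P Q HP HQ Hnz) as [h [Hh E]].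
  { intros z0; exists K, 1%R; split; [lra|auto]. }
  exists h; repeat split; auto. intros z0. apply Rnot_lt_le; intros Hlt.
  destruct (analytic_order P z0 HP Hnz) as [k [r [B [G [HG [_ [_ HPn]]]]]]].
  assert (Hr : (0 < r)%R) by apply HG.
  destruct (analytic_continuous h z0 (Cmod (h z0) - K) Hh) as [d [Hd Hc]]; [lra|].
  destruct (near_point z0 (Rmin r d)) as [z [Hne Hz]]; [now apply Rmin_glb_lt|].
  pose proof (Rmin_l r d); pose proof (Rmin_r r d).
  specialize (Hc z ltac:(lra)). specialize (HPn z ltac:(lra) Hne).
  rewrite Cmod_minus_sym in Hc. pose proof (Cmod_minus_ge (h z0) (h z)).
  specialize (HK z). rewrite E, Cmod_mult in HK. apply Cmod_gt_0 in HPn.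
  assert (Cmod (h z) <= K)%R; [|lra].
  apply Rmult_le_reg_l with (1 := HPn). lra.
Qed.

(** The functions of H^oo vanishing at [a] are multiples of [z - a], so a character is determined
    once it sends the coordinate to [a]. The quotient is bounded by [B / r] near [a] and by
    [2 M / r] beyond distance [r]; the sum covers both. *)
Lemma Hinfty_factor f (a : unit_disc) : Hinfty f ->
  exists h, Hinfty h /\ forall z : unit_disc, (f z - f a)%C = ((z - a) * h z)%C.
Proof.
  intros [Hf [M HM]]. pose proof Hf as Hw. rewrite analytic_wiener in Hw.
  destruct (Hw a) as [r [B [F [HF EF]]]]. assert (Hr : (0 < r)%R) by apply HF.
  destruct (wiener_factor _ _ _ HF) as [G [HG EG]].
  assert (E0 : f a = F 0) by now apply (wiener_at_center f F r).
  assert (HM0 : (0 <= M)%R) by (eapply Rle_trans; [apply Cmod_ge_0|apply (HM a)]).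
  pose proof (wiener_ge0 _ _ _ HG) as HB.
  assert (HMr : (0 <= 2 * M / r)%R).
  { apply Rmult_le_pos; [lra|]. now apply Rlt_le, Rinv_0_lt_compat. }
  destruct (analytic_bounded_quotient (fun z => z - a)%C (fun z => f z - f a)%C
    (B / r + 2 * M / r)) as [h [Hh [Hb E]]].
  - apply analytic_minus; [apply analytic_id|apply analytic_const].
  - apply analytic_minus; auto using analytic_const.
  - destruct (near_point a 1 Rlt_0_1) as [z [Hz _]]. exists z; now apply Csub_neq0.
  - intros z. pose proof (Cmod_ge_0 (z - a)) as Hza.
    rewrite Rmult_plus_distr_r.
    destruct (Rle_or_lt (Cmod (z - a)) r) as [Hle|Hlt].
    + rewrite EF, E0, EG by auto.
      replace (F 0 + (z - a) * G (z - a) - F 0)%C with ((z - a) * G (z - a))%C by ring.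
      rewrite Cmod_mult, Rmult_comm.
      pose proof (wiener_bound _ _ _ _ HG Hle) as H.
      pose proof (Rmult_le_compat_r _ _ _ Hza H). pose proof (Rmult_le_pos _ _ HMr Hza). lra.
    + pose proof (Cmod_triangle (f z) (- f a)) as H. rewrite Cmod_opp in H.
      pose proof (HM z); pose proof (HM a). pose proof (Rmult_le_pos _ _ HB Hza).
      assert (2 * M <= 2 * M / r * Cmod (z - a))%R; [|unfold Cminus at 1; lra].
      apply Rle_trans with (2 * M / r * r)%R; [right; field; lra|].
      apply Rmult_le_compat_l; lra.
  - exists h; split; auto. split; auto. eexists; exact Hb.
Qed.

Lemma Hinfty_inv_minus (c : C) : (1 < Cmod c)%R ->
  exists h, Hinfty h /\ forall z : unit_disc, ((z - c) * h z)%C = 1.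
Proof.
  intros Hc.
  assert (Hlow : forall z : unit_disc, (Cmod c - 1 <= Cmod (z - c))%R).
  { intros z. rewrite Cmod_minus_sym. pose proof (Cmod_minus_ge c z).
    pose proof (disc_lt1 z). lra. }
  assert (Hnz : forall z : unit_disc, (z - c)%C <> 0)
    by (intros z; apply Cmod_gt_0; specialize (Hlow z); lra).
  exists (fun z => / (z - c))%C; split; [split|].
  - apply analytic_inv; auto. apply analytic_minus; [apply analytic_id|apply analytic_const].
  - exists (/ (Cmod c - 1))%R; intros z. rewrite Cmod_inv by auto.
    apply Rinv_le_contravar; [lra|auto].
  - intros z; field; auto.
Qed.

(** * The ideal generated by psi and its automorphisms *)

Lemma psiHinfty_mul psi f : Hinfty f -> psiHinfty psi (fmul psi f).
Proof. intros; now exists f. Qed.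

Lemma psiHinfty_Hinfty psi F : Hinfty psi -> psiHinfty psi F -> Hinfty F.
Proof. intros Hpsi [f [Hf ->]]; now apply Hinfty_mul. Qed.

Lemma psiHinfty_add psi F G :
  psiHinfty psi F -> psiHinfty psi G -> psiHinfty psi (fadd F G).
Proof.
  intros [f [Hf ->]] [g [Hg ->]]. exists (fadd f g); split; [now apply Hinfty_add|].
  apply functional_extensionality; intros z; unfold fadd, fmul; ring.
Qed.

Lemma psiHinfty_scal psi c F : psiHinfty psi F -> psiHinfty psi (fscal c F).
Proof.
  intros [f [Hf ->]]. exists (fmul (fun _ => c) f); split.
  - apply Hinfty_mul; auto using Hinfty_const.
  - apply functional_extensionality; intros z; unfold fscal, fmul; ring.
Qed.

Lemma fmulE f g z : fmul f g z = (f z * g z)%C.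
Proof. reflexivity. Qed.

(* [f |-> T (psi f) / T psi] is a unital homomorphism into meromorphic functions; its
   value at a point [z] where [T psi] does not vanish is a character of H^oo, hence
   evaluation at [phi z], where [phi] is the image of the identity function. *)
Lemma automorphism_composition psi T : Hinfty psi -> (exists z, psi z <> 0) ->
  automorphism_of (psiHinfty psi) T ->
  exists phi : unit_disc -> unit_disc, analytic (fun z => dval (phi z)) /\
    forall F, psiHinfty psi F -> T F = comp_op phi F.
Proof.
  intros Hpsi Hnz [Tmap Tinj _ Tadd Tscal Tmul].
  set (A := fun f => T (fmul psi f)). set (one := fun _ : unit_disc => RtoC 1).
  set (P := A one).
  assert (H1 : Hinfty one) by apply Hinfty_const.
  assert (HA : forall f, Hinfty f -> analytic (A f)).
  { intros f Hf. apply (psiHinfty_Hinfty psi); auto. now apply Tmap, psiHinfty_mul. }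
  assert (HP : analytic P) by now apply HA.
  (* Both sides are the value at [z] of the image of [psi^2 f g], so multiplicativity needs no
     division. *)
  assert (Amul : forall f g, Hinfty f -> Hinfty g ->
    forall z, (A f z * A g z)%C = (P z * A (fmul f g) z)%C).
  { intros f g Hf Hg z. unfold P, A. rewrite <- !fmulE.
    rewrite <- !Tmul by auto using psiHinfty_mul, Hinfty_mul.
    f_equal. apply functional_extensionality; intros y; unfold fmul, one; ring. }
  assert (Asub : forall f c, Hinfty f ->
    forall z, A (fadd f (fun _ => - c)%C) z = (A f z - c * P z)%C).
  { intros f c Hf z. unfold P, A.
    replace (fmul psi (fadd f (fun _ => (- c)%C)))
      with (fadd (fmul psi f) (fscal (- c) (fmul psi one)))
      by (apply functional_extensionality; intros y; unfold fmul, fadd, fscal, one; ring).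
    rewrite Tadd, Tscal by auto using psiHinfty_mul, psiHinfty_scal.
    unfold fadd, fscal; ring. }
  (* If [T psi = 0], then [psi] and [0] have the same image, so [psi = 0]. *)
  assert (HPnz : exists z, P z <> 0).
  { apply NNPP; intros Hn. destruct Hnz as [z Hz]; apply Hz.
    assert (HP0 : T (fmul psi one) = T (fscal 0 (fmul psi one))).
    { rewrite Tscal by auto using psiHinfty_mul.
      apply functional_extensionality; intros y. unfold fscal.
      change (P y = (0 * P y)%C). rewrite Cmult_0_l.
      apply NNPP; intros Hy; apply Hn; now exists y. }
    apply Tinj in HP0; [|now apply psiHinfty_mul|now apply psiHinfty_scal, psiHinfty_mul].
    apply (f_equal (fun F => F z)) in HP0. unfold fscal, fmul, one in HP0.
    rewrite Cmult_0_l, Cmult_1_r in HP0. exact HP0. }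
  set (w := fun z : unit_disc => dval z).
  assert (Hw : Hinfty w) by apply Hinfty_id.
  assert (Hwc : forall c, Hinfty (fadd w (fun _ => - c)%C))
    by (intros c; apply Hinfty_add; auto using Hinfty_const).
  destruct (analytic_bounded_quotient P (A w) 1 HP (HA w Hw) HPnz) as [h [Hh [Hh1 Ew]]].
  (* The bound is needed at zeros of [P] too: there [(A w)^2 = P A (w^2) = 0]. Elsewhere
     [c = A w z / P z] with [|c| > 1] makes [w - c] invertible, and in [HAw] the left side is 0
     while [P z] is not. *)
  { intros z. rewrite Rmult_1_l. apply Rnot_lt_le; intros Hlt.
    assert (HAw : forall c k, Hinfty k -> (forall y : unit_disc, ((y - c) * k y)%C = 1) ->
      ((A w z - c * P z) * A k z)%C = (P z * P z)%C).
    { intros c k Hk E. rewrite <- Asub, Amul by auto. f_equal. unfold P, A.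
      do 2 f_equal. apply functional_extensionality; intros y. apply (E y). }
    destruct (excluded_middle_informative (P z = 0)) as [E0|N0].
    - assert (HA2 : (A w z * A w z)%C = 0) by (rewrite Amul, E0 by auto; ring).
      rewrite E0, Cmod_0 in Hlt. apply Cmod_gt_0 in Hlt.
      now apply (Cmult_neq_0 _ _ Hlt Hlt).
    - pose proof (proj1 (Cmod_gt_0 _) N0) as HPz.
      destruct (Hinfty_inv_minus (A w z / P z)%C) as [k [Hk Ek]].
      { rewrite Cmod_div by auto. apply Rmult_lt_reg_r with (1 := HPz).
        unfold Rdiv; rewrite Rmult_assoc, Rinv_l; lra. }
      apply (Cmult_neq_0 _ _ N0 N0). rewrite <- (HAw _ k Hk Ek). field; auto. }
  (* Otherwise the maximum principle makes [h] constant, and injectivity makes [psi w] a constant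
     multiple of [psi]. *)
  assert (Hlt1 : forall z, (Cmod (h z) < 1)%R).
  { intros z. apply Rnot_le_lt; intros Hge.
    assert (Hconst : forall y, h y = h z).
    { apply analytic_max_modulus; auto. intros y; specialize (Hh1 y); lra. }
    assert (E : fmul psi w = fmul psi (fun _ => h z)).
    { apply Tinj; auto using psiHinfty_mul, Hinfty_const.
      apply functional_extensionality; intros y.
      change (A w y = A (fun _ => h z) y). rewrite Ew, Hconst.
      replace (A (fun _ => h z)) with (fscal (h z) P); [unfold fscal; ring|].
      unfold P, A. rewrite <- Tscal by auto using psiHinfty_mul.
      f_equal. apply functional_extensionality; intros x; unfold fscal, fmul, one; ring. }
    assert (Hz : forall y : unit_disc, (y - h z)%C = 0).
    { apply (analytic_integral psi (fun y => y - h z)%C); auto; [apply Hpsi| |].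
      - apply analytic_minus; [apply analytic_id|apply analytic_const].
      - intros y. apply (f_equal (fun F => F y)) in E. unfold fmul, w in E.
        replace (psi y * (y - h z))%C with (psi y * y - psi y * h z)%C by ring.
        rewrite E; ring. }
    destruct (near_point disc0 1 Rlt_0_1) as [y [Hy _]]. apply Hy.
    transitivity ((y - h z) - (disc0 - h z) + disc0)%C; [ring|]. rewrite !Hz; ring. }
  set (phi := fun z => mk_unit_disc (h z) (Hlt1 z)).
  assert (EA : forall f, Hinfty f -> forall z, A f z = (P z * f (phi z))%C).
  { intros f Hf z.
    assert (Hfphi : analytic (fun z => f (phi z))) by (apply analytic_comp; [apply Hf|exact Hh]).
    assert (HD : forall y, (A f y - P y * f (phi y))%C = 0).
    { apply (analytic_integral P (fun y => A f y - P y * f (phi y))%C); auto.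
      - apply analytic_minus; auto. now apply analytic_mult.
      (* With [f - f (phi y) = (w - h y) k], the product at [y] becomes [(A w y - h y P y) A k y],
         which is 0 since [A w = P h]. *)
      - intros y. destruct (Hinfty_factor f (phi y) Hf) as [k [Hk Ek]].
        rewrite (Cmult_comm (P y) (f (phi y))), <- Asub by auto.
        replace (fadd f (fun _ => - f (phi y))%C)
          with (fmul (fadd w (fun _ => - h y)%C) k)
          by (apply functional_extensionality; intros x; symmetry; apply (Ek x)).
        rewrite <- Amul, Asub, Ew by auto. ring. }
    transitivity ((A f z - P z * f (phi z)) + P z * f (phi z))%C; [ring|].
    rewrite HD; ring. }
  assert (EP : forall z, P z = psi (phi z)).
  { intros z.
    assert (HD : forall y, (P y - psi (phi y))%C = 0).
    { apply (analytic_integral P (fun y => P y - psi (phi y))%C); auto.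
      - apply analytic_minus; auto. apply analytic_comp; [apply Hpsi|exact Hh].
      - intros y. transitivity (P y * P y - P y * psi (phi y))%C; [ring|].
        rewrite <- EA by auto. unfold P, A. rewrite <- fmulE.
        rewrite <- Tmul by auto using psiHinfty_mul.
        replace (fmul (fmul psi one) (fmul psi one)) with (fmul psi psi); [ring|].
        apply functional_extensionality; intros x; unfold fmul, one; ring. }
    transitivity ((P z - psi (phi z)) + psi (phi z))%C; [ring|]. rewrite HD; ring. }
  exists phi; split; [exact Hh|]. intros F [f [Hf ->]].
  apply functional_extensionality; intros z. change (A f z = comp_op phi (fmul psi f) z).
  rewrite EA, EP by auto. reflexivity.
Qed.

(** The inverse is obtained by choice, with arbitrary values off [A]. Closure of [A] under the
    operations lets each law be checked after applying [T], by injectivity. *)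
Lemma automorphism_inverse A T :
  (forall F G, A F -> A G -> A (fadd F G)) -> (forall c F, A F -> A (fscal c F)) ->
  (forall F G, A F -> A G -> A (fmul F G)) -> automorphism_of A T ->
  exists T', automorphism_of A T' /\ forall F, A F -> T' (T F) = F.
Proof.
  intros Hadd Hscal Hmul [Tmap Tinj Tsurj Tadd Tscal Tmul].
  destruct (choice (fun G F => A G -> A F /\ T F = G)) as [T' HT'].
  { intros G. destruct (excluded_middle_informative (A G)) as [HG|HG].
    - destruct (Tsurj G HG) as [F HF]; now exists F.
    - now exists G. }
  assert (Hmap : forall G, A G -> A (T' G)) by (intros; now apply HT').
  assert (HTT' : forall G, A G -> T (T' G) = G) by (intros; now apply HT').
  assert (HT'T : forall F, A F -> T' (T F) = F) by (intros; apply Tinj; auto).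
  exists T'; split; auto. split; auto.
  - intros F G HF HG E. rewrite <- (HTT' F), <- (HTT' G), E; auto.
  - intros G HG. exists (T G); auto.
  - intros F G HF HG. apply Tinj; auto. rewrite Tadd, !HTT'; auto.
  - intros c F HF. apply Tinj; auto. rewrite Tscal, !HTT'; auto.
  - intros F G HF HG. apply Tinj; auto. rewrite Tmul, !HTT'; auto.
Qed.

Lemma psiHinfty_fmul psi F G : Hinfty psi ->
  psiHinfty psi F -> psiHinfty psi G -> psiHinfty psi (fmul F G).
Proof.
  intros Hpsi [f [Hf ->]] HG. exists (fmul f G); split.
  - apply Hinfty_mul; auto. now apply (psiHinfty_Hinfty psi).
  - apply functional_extensionality; intros z; unfold fmul; ring.
Qed.

Lemma psiHinfty_psi psi : psiHinfty psi psi.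
Proof.
  exists (fun _ => RtoC 1); split; [apply Hinfty_const|].
  apply functional_extensionality; intros z; unfold fmul; ring.
Qed.

(** Testing the hypothesis on [psi] and on [psi w], with [w] the coordinate, gives
    [psi (phi o tau - w) = 0]. *)
Lemma cancel_of_psiHinfty psi (phi tau : unit_disc -> unit_disc) :
  Hinfty psi -> (exists z, psi z <> 0) ->
  analytic (fun z => dval (phi z)) -> analytic (fun z => dval (tau z)) ->
  (forall F, psiHinfty psi F -> comp_op tau (comp_op phi F) = F) -> cancel tau phi.
Proof.
  intros Hpsi Hnz Hphi Htau H z. apply dval_inj.
  assert (E : forall y : unit_disc, (phi (tau y) - y)%C = 0).
  { apply (analytic_integral psi (fun y => phi (tau y) - y)%C); auto; [apply Hpsi| |].
    - apply analytic_minus; [|apply analytic_id].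
      exact (analytic_comp (fun y => dval (phi y)) tau Hphi Htau).
    - intros y.
      pose proof (f_equal (fun F => F y) (H _ (psiHinfty_psi psi))) as E1.
      pose proof (f_equal (fun F => F y) (H _ (psiHinfty_mul psi _ Hinfty_id))) as E2.
      unfold comp_op, fmul in E1, E2. rewrite E1 in E2.
      replace (psi y * (phi (tau y) - y))%C with (psi y * phi (tau y) - psi y * y)%C by ring.
      rewrite E2; ring. }
  transitivity ((phi (tau z) - z) + z)%C; [ring|]. rewrite E; ring.
Qed.

Theorem theorem4p3 (psi : unit_disc -> C) (Hpsi : Hinfty psi)
    (psi_neq0 : exists z : unit_disc, psi z <> RtoC 0)
    (T : (unit_disc -> C) -> (unit_disc -> C)) :
  automorphism_of (psiHinfty psi) T <->
  exists phi : unit_disc -> unit_disc, Aut_disc phi /\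
    (exists g : unit_disc -> C, Hinfty_invertible g /\ comp_op phi psi = fmul psi g) /\
    (forall F : unit_disc -> C, psiHinfty psi F -> T F = comp_op phi F).
Proof.
  split.
  - intros HT.
    destruct (automorphism_inverse (psiHinfty psi) T) as [T' [HT' HTT]];
      auto using psiHinfty_add, psiHinfty_scal, psiHinfty_fmul.
    destruct (automorphism_composition psi T Hpsi psi_neq0 HT) as [phi [Hphi EphiT]].
    destruct (automorphism_composition psi T' Hpsi psi_neq0 HT') as [tau [Htau EtauT]].
    assert (Hmap := aut_maps _ _ HT). assert (Hmap' := aut_maps _ _ HT').
    assert (E1 : forall F, psiHinfty psi F -> comp_op tau (comp_op phi F) = F)
      by (intros F HF; rewrite <- EphiT, <- EtauT; auto).
    assert (E2 : forall F, psiHinfty psi F -> comp_op phi (comp_op tau F) = F).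
    { intros F HF. destruct (aut_surj _ _ HT F HF) as [G [HG <-]].
      rewrite <- (EtauT (T G)), HTT, <- EphiT; auto. }
    assert (C1 : cancel tau phi) by (apply (cancel_of_psiHinfty psi); auto).
    assert (C2 : cancel phi tau) by (apply (cancel_of_psiHinfty psi); auto).
    exists phi. split; [split; [exact Hphi|now exists tau]|]. split; [|exact EphiT].
    (* [T psi = psi g] and [T' psi = psi h]; composing the second with [phi] gives
       [psi = psi g (h o phi)], so [h o phi] inverts [g]. *)
    destruct (Hmap _ (psiHinfty_psi psi)) as [g [Hg Eg]].
    destruct (Hmap' _ (psiHinfty_psi psi)) as [h [Hh Eh]].
    rewrite EphiT in Eg by apply psiHinfty_psi. rewrite EtauT in Eh by apply psiHinfty_psi.
    exists g; split; [split; [exact Hg|]|exact Eg].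
    assert (Hhphi : Hinfty (comp_op phi h)) by now apply Hinfty_comp.
    exists (comp_op phi h); split; [exact Hhphi|]. intros z.
    assert (E : forall y, (1 - g y * comp_op phi h y)%C = 0).
    { apply (analytic_integral psi (fun y => 1 - g y * comp_op phi h y)%C); auto; [apply Hpsi| |].
      - apply analytic_minus; [apply (analytic_const 1)|]. now apply (Hinfty_mul g _ Hg).
      - intros y.
        pose proof (f_equal (fun F => F y) Eg) as Ey.
        pose proof (f_equal (fun F => F (phi y)) Eh) as Ey'.
        unfold comp_op, fmul in Ey, Ey'. rewrite C2, Ey in Ey'.
        unfold comp_op.
        transitivity (psi y - psi y * g y * h (phi y))%C; [ring|]. rewrite <- Ey'; ring. }
    transitivity (1 - (1 - g z * comp_op phi h z))%C; [ring|]. rewrite E; ring.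
  - intros [phi [Haut [[g [[Hg [k [Hk Egk]]] Eg]] ET]]].
    pose proof Haut as [Hphi [tau C1 C2]].
    pose proof (Aut_disc_inv phi tau Haut C2) as Htau.
    split.
    + intros F HF. rewrite ET by auto. destruct HF as [f [Hf ->]].
      exists (fmul g (comp_op phi f)); split; [apply Hinfty_mul; auto; now apply Hinfty_comp|].
      apply functional_extensionality; intros z.
      pose proof (f_equal (fun F => F z) Eg) as Ez. unfold comp_op, fmul in *. rewrite Ez; ring.
    + intros F G HF HG E. rewrite !ET in E by auto.
      apply functional_extensionality; intros z. rewrite <- (C2 z).
      exact (f_equal (fun F => F (tau z)) E).
    + intros G [f [Hf ->]].
      (* The preimage of [psi f]: composition with [phi] turns [psi] into [psi g], and the factor
         [k], the inverse of [g], undoes this. *)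
      assert (HF : psiHinfty psi (fmul psi (comp_op tau (fmul f k))))
        by (apply psiHinfty_mul, Hinfty_comp; auto using Hinfty_mul).
      exists (fmul psi (comp_op tau (fmul f k))); split; auto. rewrite ET by auto.
      apply functional_extensionality; intros z.
      pose proof (f_equal (fun F => F z) Eg) as Ez. unfold comp_op, fmul in *.
      rewrite C1, Ez. transitivity (psi z * f z * (g z * k z))%C; [ring|]. rewrite Egk; ring.
    + intros F G HF HG. rewrite !ET; auto using psiHinfty_add.
    + intros c F HF. rewrite !ET; auto using psiHinfty_scal.
    + intros F G HF HG. rewrite !ET; auto using psiHinfty_fmul.
Qed.
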